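(* Let $a,b,c>0$. Each of the maps $F_{b,a}$ and $F_{c,b,a}$ has a unique fixed point in $Q^+$, denoted in each case by $\mathbf{p}$, and the following hold. (i) The (nonempty) level sets of $V_{b,a}$ (resp. of $V_{c,b,a}$) in $Q^+\setminus\{\mathbf{p}\}$ are diffeomorphic to circles surrounding $\mathbf{p}$, where $\mathbf{p}$ is the unique fixed point of $F_{b,a}$ (resp. of $F_{c,b,a}$) in $Q^+$. (ii) The action of $F_{b,a}$ (resp. of $F_{c,b,a}$) on each level set of $V_{b,a}$ (resp. of $V_{c,b,a}$) contained in $Q^+\setminus\{\mathbf{p}\}$ is conjugated to a rotation of the circle.
   Context: $Q^+=\{(x,y)\in\mathbb{R}^2: x>0,\ y>0\}$. For $\alpha>0$, $F_\alpha:Q^+\to Q^+$ is the map $F_\alpha(x,y)=\left(y,\frac{\alpha+y}{x}\right)$. For $a,b,c>0$, $$F_{b,a}(x,y)=F_b\circ F_a(x,y)=\left(\frac{a+y}{x},\frac{a+bx+y}{xy}\right),$$ $$F_{c,b,a}(x,y)=F_c\circ F_b\circ F_a(x,y)=\left(\frac{a+bx+y}{xy},\frac{a+bx+y+cxy}{y(a+y)}\right).$$ The functions $V_{b,a},V_{c,b,a}:Q^+\to\mathbb{R}$ are $$V_{b,a}(x,y)=\frac{ax^2y+bxy^2+bx^2+ay^2+(b^2+a)x+(b+a^2)y+ab}{xy},$$ $$V_{c,b,a}(x,y)=\frac{cx^2y+axy^2+bx^2+by^2+(a+bc)x+(c+ab)y+ac}{xy};$$ they are first integrals of $F_{b,a}$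 and $F_{c,b,a}$ respectively, that is, $V_{b,a}\circ F_{b,a}=V_{b,a}$ and $V_{c,b,a}\circ F_{c,b,a}=V_{c,b,a}$ on $Q^+$. A simple closed curve surrounds $\mathbf{p}$ if $\mathbf{p}$ lies in the bounded component of its complement in $\mathbb{R}^2$. *)

(* Defs.v *)
From HB Require Import structures.
From mathcomp Require Import all_boot all_order all_algebra.
From mathcomp Require Import all_classical all_reals all_analysis.

Set Implicit Arguments.
Unset Strict Implicit.
Unset Printing Implicit Defensive.

Import Order.TTheory GRing.Theory Num.Theory.
Import numFieldNormedType.Exports.

Local Open Scope classical_set_scope.
Local Open Scope ring_scope.

Section Lyness.
Variable R : realType.
Implicit Types (a b c h : R) (p z : R * R).

Definition Qplus : set (R * R) := [set p | 0 < p.1 /\ 0 < p.2].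

(* The maps below are total on R * R; only their restriction to Qplus, which
   they preserve for positive parameters, is meaningful (x / 0 = 0). *)
Definition lyness a p : R * R := (p.2, (a + p.2) / p.1).

Definition lyness2 b a : R * R -> R * R := lyness b \o lyness a.

Definition lyness3 c b a : R * R -> R * R := lyness c \o (lyness b \o lyness a).

Definition V2 b a p : R :=
  let: (x, y) := p in
  (a * x ^+ 2 * y + b * x * y ^+ 2 + b * x ^+ 2 + a * y ^+ 2
   + (b ^+ 2 + a) * x + (b + a ^+ 2) * y + a * b) / (x * y).

Definition V3 c b a p : R :=
  let: (x, y) := p in
  (c * x ^+ 2 * y + a * x * y ^+ 2 + b * x ^+ 2 + b * y ^+ 2
   + (a + b * c) * x + (c + a * b) * y + a * c) / (x * y).

Definition level_set (D : set (R * R)) (V : R * R -> R) h : set (R * R) :=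
  [set q | D q /\ V q = h].

Definition unit_circle : set (R * R) := [set z | z.1 ^+ 2 + z.2 ^+ 2 = 1].

Definition rotation (theta : R) z : R * R :=
  (cos theta * z.1 - sin theta * z.2, sin theta * z.1 + cos theta * z.2).

(* C^n regularity on an open set U.  Asking for differentiability and for all
   directional derivatives to be C^n, rather than for the two partial
   derivatives only, defines the same class, as the domain is
   finite-dimensional. *)
Fixpoint is_Cn (n : nat) (U : set (R * R)) (f : R * R -> R * R) : Prop :=
  match n with
  | 0%N => forall q, U q -> {for q, continuous f}
  | m.+1 => (forall q, U q -> differentiable f q) /\
            (forall v : R * R, is_Cn m U (fun q => 'D_v f q))
  end.

(* Smoothness on an arbitrary subset X of the plane: f coincides on X, near
   each point of X, with a C^oo map defined on an open set. *)
Definition smooth_on (X : set (R * R)) (f : R * R -> R * R) : Prop :=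
  forall q, X q -> exists (U : set (R * R)) (g : R * R -> R * R),
    [/\ open U, U q, forall n, is_Cn n U g & {in U `&` X, f =1 g}].

Definition mutually_inverse (X Y : set (R * R)) (f g : R * R -> R * R) : Prop :=
  [/\ set_fun X Y f, set_fun Y X g, {in X, cancel f g} & {in Y, cancel g f}].

Definition diffeomorphic (X Y : set (R * R)) : Prop :=
  exists f g : R * R -> R * R,
    [/\ mutually_inverse X Y f g, smooth_on X f & smooth_on Y g].

(* p lies in a bounded component of the complement of C; for a simple closed
   curve C there is exactly one such component. The clause ~ C p is needed
   because connected_component A p is empty when p is not in A. *)
Definition surrounds (C : set (R * R)) p : Prop :=
  ~ C p /\ bounded_set (connected_component (~` C) p).

(* Topological conjugacy between the restriction of F to X and a rotation. *)
Definition conjugate_to_rotation (X : set (R * R)) (F : R * R -> R * R) : Prop :=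
  set_fun X X F /\
  exists (theta : R) (phi psi : R * R -> R * R),
    [/\ mutually_inverse X unit_circle phi psi,
        {within X, continuous phi},
        {within unit_circle, continuous psi} &
        forall q, X q -> phi (F q) = rotation theta (phi q)].

End Lyness.

Arguments Qplus {R}.
Arguments unit_circle {R}.

(* Main.v *)
(* Clearing denominators, the level set {V = h} is the cubic
   A(x) y^2 + B(x) y + C(x) = 0 with h only in B.  Its discriminant
   B^2 - 4AC is a quartic with four real roots 0 <= x0 < x1 < x2 < x3 as soon
   as h > V(p), and the level set lies over [x1, x2].  Hence
     (2Ay + B)^2 = dd(x) (x - x1)(x2 - x)  with  dd > 0 on ]x0, x3[,
   so (x, (2Ay + B) / sqrt(dd)) maps it onto a circle, with an explicit inverse.
   The fixed point p is the strict minimum of V, since V is a sum of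
   exponentials in (ln x, ln y).

   Every Lyness map preserves dx dy / (xy) and permutes the functions V
   cyclically, so F commutes with the Hamiltonian flow xy (-V_y, V_x).  In the
   circle coordinate this flow is the scalar equation
   theta' = sqrt(dd(m + r cos theta)), whose solutions are obtained by inverting
   a primitive; they are periodic and sweep the whole level curve.  By uniqueness
   of solutions F is a time shift along the flow, that is, a rotation. *)
Require Import Defs.
From mathcomp Require Import all_boot all_order all_algebra.
From mathcomp Require Import all_classical all_reals all_analysis.
From mathcomp Require Import ring lra.
From mathcomp Require polyrcf.
Import Order.TTheory GRing.Theory Num.Theory.
Import numFieldNormedType.Exports.
Local Open Scope classical_set_scope.
Local Open Scope ring_scope.
Set Implicit Arguments.
Unset Strict Implicit.
Unset Printing Implicit Defensive.

(** * Smoothness of elementary functions *)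

(* A class of functions closed under directional derivatives, so that C^n
   regularity for all n follows by a single induction. *)
Inductive elementary {R : realType} (U : set (R * R)) : (R * R -> R) -> Prop :=
| elem_cst k : elementary U (fun=> k)
| elem_fst : elementary U fst
| elem_snd : elementary U snd
| elem_add f g : elementary U f -> elementary U g ->
    elementary U (fun q => f q + g q)
| elem_mul f g : elementary U f -> elementary U g ->
    elementary U (fun q => f q * g q)
| elem_inv f : elementary U f -> (forall q, U q -> f q != 0) ->
    elementary U (fun q => (f q)^-1)
| elem_sqrt f : elementary U f -> (forall q, U q -> 0 < f q) ->
    elementary U (fun q => Num.sqrt (f q)).

Lemma differentiable_sqrt_comp {R : realType} (f : R * R -> R) q v :
  differentiable f q -> 0 < f q ->
  differentiable (fun z => Num.sqrt (f z)) q /\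
  'D_v (fun z => Num.sqrt (f z)) q = (2 * Num.sqrt (f q))^-1 * 'D_v f q.
Proof.
move=> df f0; have hs := is_derive1_sqrt f0.
have ds : differentiable (@Num.sqrt R) (f q).
  by apply/derivable1_diffP; exact: ex_derive.
have dc : differentiable (Num.sqrt \o f) q by exact: differentiable_comp.
split => //; rewrite deriveE// diff_comp//= deriveE//.
have -> : 'd (@Num.sqrt R) (f q) ('d f q v) =
   'd f q v *: 'd (@Num.sqrt R) (f q) 1.
  by rewrite -linearZ /= /GRing.scale /= mulr1.
by rewrite -[X in _ *: X]deriveE// derive_val /GRing.scale/= mulrC.
Qed.

Lemma derive_fst {R : realType} (q v : R * R) :
  differentiable (@fst R R) q /\ 'D_v (@fst R R) q = v.1.
Proof.
have cf : continuous (@fst R R) by move=> z; exact: cvg_fst.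
have df : differentiable (@fst R R) q by exact: linear_differentiable.
by split=> //; rewrite deriveE// diff_lin.
Qed.

Lemma derive_snd {R : realType} (q v : R * R) :
  differentiable (@snd R R) q /\ 'D_v (@snd R R) q = v.2.
Proof.
have cf : continuous (@snd R R) by move=> z; exact: cvg_snd.
have df : differentiable (@snd R R) q by exact: linear_differentiable.
by split=> //; rewrite deriveE// diff_lin.
Qed.

(** Inverses and square roots have derivatives built from inverses and roots of the same function.
    The derivative is matched with an elementary function on [U] only, where the side conditions of
    [elem_inv] and [elem_sqrt] hold. *)
Lemma elementary_derive {R : realType} (U : set (R * R)) f :
  elementary U f ->
  (forall q, U q -> differentiable f q) /\
  (forall v, exists2 f', elementary U f' & forall q, U q -> 'D_v f q = f' q).
Proof.
elim=> {f}.
- move=> k; split=> [q _|v]; first exact: differentiable_cst.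
  exists (fun=> 0); first exact: elem_cst.
  by move=> q _; rewrite derive_cst.
- split=> [q _|v]; first exact: (derive_fst q 0).1.
  exists (fun=> v.1); first exact: elem_cst.
  by move=> q _; exact: (derive_fst q v).2.
- split=> [q _|v]; first exact: (derive_snd q 0).1.
  exists (fun=> v.2); first exact: elem_cst.
  by move=> q _; exact: (derive_snd q v).2.
- move=> f g ef [df Df] eg [dg Dg]; split=> [q Uq|v].
    by apply: differentiableD; [exact: df|exact: dg].
  have [f' ef' Ef] := Df v; have [g' eg' Eg] := Dg v.
  exists (fun q => f' q + g' q); first exact: elem_add.
  move=> q Uq; rewrite -Ef// -Eg//; apply: deriveD.
    exact/diff_derivable/df.
  exact/diff_derivable/dg.
- move=> f g ef [df Df] eg [dg Dg]; split=> [q Uq|v].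
    by apply: differentiableM; [exact: df|exact: dg].
  have [f' ef' Ef] := Df v; have [g' eg' Eg] := Dg v.
  exists (fun q => f q * g' q + g q * f' q).
    by apply: elem_add; apply: elem_mul.
  move=> q Uq; rewrite -Ef// -Eg//; apply: deriveM.
    exact/diff_derivable/df.
  exact/diff_derivable/dg.
- move=> f ef [df Df] f0; split=> [q Uq|v].
    by apply: differentiableV; [exact: df|exact: f0].
  have [f' ef' Ef] := Df v.
  exists (fun q => (-1) * ((f q)^-1 * (f q)^-1) * f' q).
    apply: elem_mul => //; apply: elem_mul; first exact: elem_cst.
    by apply: elem_mul; apply: elem_inv.
  move=> q Uq; rewrite -Ef// deriveV; [|exact: f0|exact/diff_derivable/df].
  by rewrite /GRing.scale/= expr2 invfM mulN1r.
- move=> f ef [df Df] f0; split=> [q Uq|v].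
    exact: (differentiable_sqrt_comp 0 (df q Uq) (f0 q Uq)).1.
  have [f' ef' Ef] := Df v.
  exists (fun q => (2 * Num.sqrt (f q))^-1 * f' q).
    apply: elem_mul => //; apply: elem_inv.
      by apply: elem_mul; [exact: elem_cst|exact: elem_sqrt].
    by move=> q Uq; rewrite mulf_neq0// ?pnatr_eq0// gt_eqF// sqrtr_gt0 f0.
  move=> q Uq; rewrite -Ef//.
  exact: (differentiable_sqrt_comp v (df q Uq) (f0 q Uq)).2.
Qed.

Lemma near0_differentiable {R : realType} (V W : normedModType R) (f : V -> W) q :
  (\forall z \near q, f z = 0) -> differentiable f q.
Proof.
move=> f0.
have fq : f q = 0 by exact: nbhs_singleton f0.
have f0q : \forall z \near (0 : V), f (z + q) = 0.
  by move: f0; rewrite (near_shift 0 q) subr0.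
(* The remainder after the zero map vanishes near the origin, so it is negligible, and uniqueness of
   the differential applies. *)
have H : f \o shift q = cst (f q) + (\0 : V -> W) +o_ 0 id.
  apply/eqaddoP => e e0; near=> z.
  have -> : (f \o shift q - (cst (f q) + (\0 : V -> W))) z = 0.
    by rewrite !fctE /= fq !addr0 subr0; near: z.
  by rewrite normr0 mulr_ge0// ltW.
have c0 : continuous (\0 : V -> W) by move=> z; exact: cvg_cst.
by apply/diff_locallyP; rewrite (diff_unique c0 H).
Unshelve. all: by end_near.
Qed.

Lemma near_differentiable {R : realType} (V W : normedModType R) (f g : V -> W) q :
  (\forall z \near q, f z = g z) -> differentiable f q -> differentiable g q.
Proof.
move=> fg df; rewrite (_ : g = f + (g - f)); last by rewrite addrC subrK.
apply: differentiableD => //; apply: near0_differentiable.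
by apply: filterS fg => z fgz; rewrite !fctE fgz subrr.
Qed.

(** Since [U] is open, agreement on [U] is agreement near each of its points, which passes to
    directional derivatives. An elementary formula can thus stand for a derivative. *)
Lemma is_Cn_eq {R : realType} (U : set (R * R)) (n : nat) f g :
  open U -> (forall q, U q -> f q = g q) -> is_Cn n U f -> is_Cn n U g.
Proof.
move=> oU; elim: n f g => [|n IH] f g fg /=.
  move=> cf q Uq; move: (cf q Uq); rewrite /prop_for/continuous_at -fg//.
  apply: cvg_trans; apply: near_eq_cvg.
  by apply: filterS (open_nbhs_nbhs (conj oU Uq)) => z /fg.
have nfg q : U q -> \forall z \near q, f z = g z.
  by move=> Uq; apply: filterS (open_nbhs_nbhs (conj oU Uq)) => z /fg.
move=> [df Df]; split=> [q Uq|v].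
  exact: near_differentiable (nfg q Uq) (df q Uq).
apply: (IH _ _ _ (Df v)) => q Uq.
have [->|v0] := eqVneq v 0.
  by rewrite !derive0. 
by apply: near_eq_derive => //; exact: nfg.
Qed.

(** Induction on [n] with both components general: on [U], a directional derivative of the pair is
    again a pair of elementary functions. *)
Lemma elementary_Cn {R : realType} (U : set (R * R)) f g n :
  open U -> elementary U f -> elementary U g ->
  is_Cn n U (fun q => (f q, g q)).
Proof.
move=> oU; elim: n f g => [|n IH] f g ef eg /=;
  have [df Df] := elementary_derive ef;
  have [dg Dg] := elementary_derive eg.
  move=> q Uq; apply: differentiable_continuous.
  by apply: differentiable_pair; [exact: df|exact: dg].
split=> [q Uq|v].
  by apply: differentiable_pair; [exact: df|exact: dg].
have [f' ef' Ef] := Df v; have [g' eg' Eg] := Dg v.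
apply: (is_Cn_eq oU _ (IH _ _ ef' eg')) => // q Uq.
have [dfq dgq] := (df q Uq, dg q Uq).
rewrite -Ef// -Eg// [RHS]deriveE; last exact: differentiable_pair.
by rewrite diff_pair// !deriveE.
Qed.

Lemma elementary_smooth_on {R : realType} (U X : set (R * R)) f g :
  open U -> X `<=` U -> elementary U f -> elementary U g ->
  smooth_on X (fun q => (f q, g q)).
Proof.
move=> oU XU ef eg q Xq; exists U, (fun q => (f q, g q)); split=> //.
- exact: XU.
- by move=> n; exact: elementary_Cn.
Qed.

(** * Conjugacies from periodic parametrizations *)

(** The preimage of a closed set under [h] is the image by [f] of a closed part of the compact [K],
    hence compact, hence closed in the Hausdorff space [X]. *)
Lemma quotient_continuous (T X Y : topologicalType) (K : set T) (f : T -> X)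
    (h : X -> Y) :
  hausdorff_space X -> compact K -> continuous f -> continuous (h \o f) ->
  {within f @` K, continuous h}.
Proof.
move=> hX cK cf chf; apply/continuous_closedP => C cC.
apply/closed_subspaceP; exists (f @` (K `&` (h \o f) @^-1` C)).
  apply: compact_closed => //; apply: continuous_compact.
    exact: continuous_subspaceT.
  apply: compact_closedI => //.
  by move/continuous_closedP: chf => /(_ _ cC).
apply/seteqP; split=> x /=.
  by move=> [[t [Kt hft] <-] _]; split=> //; exists t.
by move=> [hx [t Kt ftx]]; split; exists t => //; split=> //; rewrite /= ftx.
Qed.

Lemma circle_param_continuous (R : realType) :
  continuous (fun s : R => (cos s, sin s)).
Proof.
move=> s; have h1 := @continuous_cos R s; have h2 := @continuous_sin R s.
exact: (cvg_pair h1 h2).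
Qed.

Lemma circle_param_surj (R : realType) (z : R * R) : unit_circle z ->
  exists2 s, 0 <= s <= pi *+ 2 & (cos s, sin s) = z.
Proof.
case: z => x y; rewrite /unit_circle/= => xy1.
have x1 : -1 <= x <= 1 by apply/andP; split; nra.
have y2 : 1 - x ^+ 2 = y ^+ 2 by lra.
have [a0 api] := (acos_ge0 x1, acos_lepi x1).
have [y0|y0] := leP 0 y.
  exists (acos x); first by rewrite a0/= (le_trans api)// mulr2n lerDl pi_ge0.
  by rewrite acosK// sin_acos// y2 sqrtr_sqr ger0_norm.
(* On the lower half circle the angle is [2 pi - acos x]. *)
exists (- acos x + pi *+ 2).
  have := pi_ge0 R; rewrite mulr2n => p0; apply/andP; split; lra.
rewrite cosD2pi sinD2pi cosN sinN acosK// sin_acos// y2 sqrtr_sqr ltr0_norm//.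
by rewrite opprK.
Qed.

Lemma circle_param_period (R : realType) (s : R) (k : int) :
  (cos (s + k%:~R * (pi *+ 2)), sin (s + k%:~R * (pi *+ 2))) = (cos s, sin s).
Proof.
case: k => n; last first.
  rewrite NegzE mulrNz mulNr -[s in RHS](subrK (n.+1%:~R * (pi *+ 2))).
  by rewrite mulr_natl (periodicn (@cosD2pi R)) (periodicn (@sinD2pi R)).
by rewrite mulr_natl (periodicn (@cosD2pi R)) (periodicn (@sinD2pi R)).
Qed.

(** Reduce [d] modulo [2 pi] to [r] in [[0, 2 pi[]. Injectivity of cosine on [[0, pi]] gives [r = 0]
    in the first half; in the second half it would make [2 pi - r] vanish. *)
Lemma cos_eq1 (R : realType) (d : R) : cos d = 1 ->
  exists k : int, d = k%:~R * (pi *+ 2).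
Proof.
move=> cd; have p0 := pi_gt0 R.
have p2 : 0 < (pi : R) *+ 2 by rewrite pmulrn_lgt0.
pose k := Num.floor (d / (pi *+ 2)); exists k.
pose r := d - k%:~R * (pi *+ 2).
have r0 : 0 <= r by rewrite subr_ge0 -ler_pdivlMr// ge_floor.
have r2 : r < pi *+ 2.
  rewrite ltrBlDl -[X in _ + X]mul1r -mulrDl -ltr_pdivrMr//.
  by have := lt_succ_floor (d / (pi *+ 2)); rewrite intrD.
have cr : cos r = 1.
  rewrite -cd; have [] := circle_param_period d (- k).
  by rewrite mulrNz mulNr => -> _.
suff : r = 0 by move/eqP; rewrite subr_eq0 => /eqP.
have [rp|rp] := leP r pi.
  apply: cos_inj; rewrite ?in_itv/= ?r0 ?rp ?lexx ?ltW//.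
  by rewrite cr cos0.
have e : cos (pi *+ 2 - r) = 1 by rewrite addrC cosD2pi cosN.
have : pi *+ 2 - r = 0.
  apply: cos_inj; rewrite ?in_itv/= ?lexx ?(ltW p0)//.
    by move: r2 rp; rewrite mulr2n => r2 rp; apply/andP; split; lra.
  by rewrite e cos0.
by move=> h; move: r2; lra.
Qed.

Lemma circle_param_eq (R : realType) (s t : R) :
  (cos s, sin s) = (cos t, sin t) <->
  exists k : int, t = s + k%:~R * (pi *+ 2).
Proof.
split=> [[ec es]|[k ->]]; last by rewrite circle_param_period.
have [k ek] : exists k : int, t - s = k%:~R * (pi *+ 2).
  by apply: cos_eq1; rewrite cosB ec es -!expr2 cos2Dsin2.
by exists k; rewrite -ek addrC subrK.
Qed.

(* [G] and the standard parametrization of the circle have the same fibres, so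
   each factors through the other; compactness makes both factors continuous. *)
Lemma conjugate_of_param (R : realType) (L : set (R * R)) (F : R * R -> R * R)
    (G : R -> R * R) (tau : R) :
  continuous G -> (forall s, L (G s)) ->
  (forall q, L q -> exists2 s, 0 <= s <= pi *+ 2 & G s = q) ->
  (forall s t, G s = G t <-> (cos s, sin s) = (cos t, sin t)) ->
  (forall s, F (G s) = G (s + tau)) ->
  conjugate_to_rotation L F.
Proof.
move=> cG LG sG fib FG.
split=> [q /= Lq|]; first by have [s _ <-] := sG q Lq; rewrite FG.
pose E (s : R) := (cos s, sin s).
have cE : continuous E := @circle_param_continuous R.
have UE s : unit_circle (E s) by rewrite /unit_circle/= cos2Dsin2.
(* [get] picks some parameter of the point; equality of the fibres makes the result independent of
   the choice. *)
pose phi q := E (get [set s | G s = q]).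
pose psi z := G (get [set s | E s = z]).
have phiG s : phi (G s) = E s.
  apply/fib; rewrite -/(E _).
  by apply: (@getPex _ [set t | G t = G s]); exists s.
have psiE s : psi (E s) = G s.
  apply/fib; rewrite -!/(E _).
  by apply: (@getPex _ [set t | E t = E s]); exists s.
have GK : G @` `[0, pi *+ 2] = L.
  apply/seteqP; split=> [_ [s _ <-]//|q /sG[s s0 <-]].
  by exists s => //=; rewrite in_itv.
have EK : E @` `[0, pi *+ 2] = unit_circle.
  apply/seteqP; split=> [_ [s _ <-]//|q /circle_param_surj[s s0 <-]].
  by exists s => //=; rewrite in_itv.
have hR2 : hausdorff_space (R * R)%type.
  exact: norm_hausdorff.
exists tau, phi, psi; split.
- split.
  + by move=> q /= /sG[s _ <-]; rewrite phiG.
  + by move=> z /= /circle_param_surj[s _ <-]; rewrite psiE.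
  + by move=> q /set_mem /sG[s _ <-]; rewrite phiG psiE.
  + by move=> z /set_mem /circle_param_surj[s _ <-]; rewrite -/(E s) psiE phiG.
- rewrite -GK; apply: quotient_continuous => //; first exact: segment_compact.
  by rewrite (_ : phi \o G = E)//; apply/funext.
- rewrite -EK; apply: quotient_continuous => //; first exact: segment_compact.
  by rewrite (_ : psi \o E = G)//; apply/funext.
- move=> q /sG[s _ <-]; rewrite FG !phiG /rotation/E/= cosD sinD.
  by congr (_, _); ring.
Qed.

(** * Autonomous differential equations *)

Lemma is_derive_const_on (R : realType) (D : R -> R) (a : R) :
  (forall x : R, a < x -> is_derive x 1 D 0) ->
  forall x y, a < x -> a < y -> D x = D y.
Proof.
move=> dD x y ax ay; wlog xy : x y ax ay / x <= y.
  by move=> H; have [xy|/ltW yx] := leP x y; [exact: H|apply/esym; exact: H].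
have [||c _] := @MVT_segment R D (fun=> 0) x y xy.
- by move=> z; rewrite in_itv/= => /andP[xz _]; apply: dD; exact: lt_trans xz.
- apply: continuous_in_subspaceT => z /set_mem/=.
  rewrite in_itv/= => /andP[xz _].
  have dz : is_derive z 1 D 0 by apply: dD; exact: lt_le_trans xz.
  by apply/differentiable_continuous/derivable1_diffP; exact: ex_derive.
by rewrite mul0r => /eqP; rewrite subr_eq0 => /eqP.
Qed.

Lemma continuous_primitive_ray (R : realType) (f : R -> R) (a : R) :
  continuous f -> exists F : R -> R, forall x : R, a < x -> is_derive x 1 F (f x).
Proof.
move=> cf; exists (fun x => \int[lebesgue_measure]_(t in `[a, x]) f t) => x ax.
have x1 : x < x + 1 by rewrite ltrDl.
have [|dF eF] := @continuous_FTC1_closed R f a x _ x1 _ ax (cf x).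
  apply: continuous_compact_integrable; first exact: segment_compact.
  exact: continuous_subspaceT.
apply: DeriveDef; first exact: dF.
by rewrite -derive1E; exact: eF.
Qed.

(* The library integrates from a fixed left end-point, so the primitives on the
   rays ]-M, +oo[ are normalized at 0 and glued. *)
Lemma continuous_primitive (R : realType) (f : R -> R) :
  continuous f -> exists F : R -> R, forall x : R, is_derive x 1 F (f x).
Proof.
move=> cf.
have /choice[J dJ] := fun a => @continuous_primitive_ray R f a cf.
pose N M x := J (- M) x - J (- M) 0.
have dN (M x : R) : - M < x -> is_derive x 1 (N M) (f x).
  move=> Mx; have := dJ (- M) x Mx => dJx; rewrite -[f x]subr0.
  exact: is_deriveB.
have NN (M M' x : R) : 0 < M -> M <= M' -> - M < x -> N M x = N M' x.
  move=> M0 MM' Mx; apply/eqP; rewrite -subr_eq0; apply/eqP.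
  have -> : 0 = N M 0 - N M' 0 by rewrite /N !subrr.
  apply: (@is_derive_const_on R (N M - N M') (- M)) => //.
  - move=> y My; rewrite -(subrr (f y)).
    apply: is_deriveB; apply: dN => //.
    by rewrite (le_lt_trans _ My)// lerN2.
  - by rewrite oppr_lt0.
exists (fun x => N (`|x| + 1) x) => x.
(* The radius [|x| + 1] varies with the point. Near [x] all these radii are at most [|x| + 2], so
   one fixed primitive serves there. *)
apply: (@near_eq_is_derive _ _ _ (N (`|x| + 2))); last first.
  by apply: dN; rewrite ltrNl; have := ler_norm (- x); rewrite normrN; lra.
near=> y.
have xy : `|x - y| < 1 by near: y; apply: cvgr_dist_lt => //; exact: cvg_id.
apply/esym; apply: NN.
- by rewrite ltr_wpDl.
- have : `|y| <= `|x| + `|x - y| by rewrite distrC -[y in leLHS](subrKC x) ler_normD.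
  by lra.
- by rewrite ltrNl; have := ler_norm (- y); rewrite normrN; lra.
Unshelve. all: by end_near. Qed.

Lemma pos_derive_increasing (R : realType) (F f : R -> R) :
  (forall x : R, is_derive x 1 F (f x)) -> (forall x, 0 < f x) ->
  {homo F : x y / x < y}.
Proof.
move=> dF f0 x y xy.
have [|z _] := @MVT R F f x y xy (fun z _ => dF z).
  apply: continuous_subspaceT => z.
  apply/differentiable_continuous/derivable1_diffP.
  by have := dF z => dz; exact: ex_derive.
by move=> e; rewrite -subr_gt0 e mulr_gt0// subr_gt0.
Qed.

Lemma quasi_periodic_int (R : realType) (F : R -> R) (p : R) :
  (forall x, F (x + p) = F x + p) ->
  forall x (k : int), F (x + k%:~R * p) = F x + k%:~R * p.
Proof.
move=> Fp.
have Fn x (n : nat) : F (x + n%:R * p) = F x + n%:R * p.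
  elim: n => [|n IH]; first by rewrite !mul0r !addr0.
  by rewrite -natr1 mulrDl mul1r !addrA Fp IH.
move=> x [n|n]; first exact: Fn.
by rewrite NegzE mulrNz mulNr -[in RHS](subrK (n.+1%:R * p) x) Fn addrK.
Qed.

(** The floor of [(y - F 0) / p] gives consecutive multiples of [p] whose images enclose [y]; the
    intermediate value theorem concludes. *)
Lemma quasi_periodic_surj (R : realType) (F : R -> R) (p : R) :
  0 < p -> continuous F -> (forall x, F (x + p) = F x + p) ->
  forall y, exists x, F x = y.
Proof.
move=> p0 cF Fp y.
pose k := Num.floor ((y - F 0) / p).
have := quasi_periodic_int Fp 0 k; have := quasi_periodic_int Fp 0 (k + 1).
rewrite !add0r => F1 F0.
have k0 : k%:~R * p <= y - F 0 by rewrite -ler_pdivlMr// ge_floor.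
have k1 : y - F 0 <= (k + 1)%:~R * p.
  by rewrite -ler_pdivrMr// ltW// lt_succ_floor.
have kk : k%:~R * p <= (k + 1)%:~R * p by exact: le_trans k0 k1.
have [||c _ <-] := @IVT R F _ _ y kk.
- exact: continuous_subspaceT.
- have h1 : F (k%:~R * p) <= y by rewrite F0; lra.
  have h2 : y <= F ((k + 1)%:~R * p) by rewrite F1; lra.
  by rewrite ge_min le_max h1 h2 orbT.
- by exists c.
Qed.

(** Separation of variables: [Th] inverts a primitive of [1 / g]. With [T] the increase of this
    primitive over one period, the scaling by [p / T] makes the period of the solution [p] as well,
    and [w] is [T / p]. *)
Lemma periodic_ode (R : realType) (g : R -> R) (p : R) :
  0 < p -> continuous g -> (forall x, 0 < g x) -> periodic g p ->
  exists (w : R) (Th : R -> R),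
    [/\ forall s : R, is_derive s 1 Th (w * g (Th s)),
        forall s, Th (s + p) = Th s + p,
        injective Th & forall y, exists x, Th x = y].
Proof.
move=> p0 cg g0 gp.
have [F0 dF0] : exists F : R -> R, forall x : R, is_derive x 1 F (g x)^-1.
  apply: continuous_primitive => x; apply: cvgV; last exact: cg.
  by rewrite gt_eqF.
pose T := F0 p - F0 0.
have T0 : 0 < T.
  rewrite subr_gt0; apply: (pos_derive_increasing dF0) => // x.
  by rewrite invr_gt0.
have wT0 : 0 < p / T by rewrite divr_gt0.
pose F x := (p / T) * F0 x.
have dF (x : R) : is_derive x 1 F ((p / T) * (g x)^-1).
  by have := dF0 x => dx; exact: is_deriveZ.
have cF : continuous F.
  move=> x; apply/differentiable_continuous/derivable1_diffP.
  by have := dF x => dx; exact: ex_derive.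
(* Periodicity of [g] makes the increment of [F0] over [p] a function of zero derivative, hence the
   constant [T]. *)
have Fp x : F (x + p) = F x + p.
  pose D x := F0 (x + p) - F0 x.
  have dD (y : R) : is_derive y 1 D 0.
    have -> : 0 = (g (y + p))^-1 * 1 - (g y)^-1 by rewrite gp mulr1 subrr.
    have d1 := dF0 (y + p); have d2 := dF0 y.
    apply: is_deriveB.
    apply: (@is_derive1_comp _ F0 (fun y => y + p)).
    by rewrite -[X in is_derive _ _ _ X]addr0; apply: is_deriveD.
  have : D x = T by rewrite (is_derive_0_is_cst x 0 dD) /D add0r.
  rewrite /D => Dx; rewrite /F.
  have -> : F0 (x + p) = F0 x + T by rewrite -Dx subrKC.
  by rewrite mulrDr divfK// gt_eqF.
have incF : {homo F : x y / x < y}.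
  apply: (pos_derive_increasing dF) => x.
  by rewrite mulr_gt0// invr_gt0.
have injF : injective F.
  move=> x y e; have [/incF|/incF|//] := ltgtP x y; by rewrite e ltxx.
have /choice[Th FTh] := quasi_periodic_surj p0 cF Fp.
have ThF : cancel F Th by move=> x; apply: injF; rewrite FTh.
exists (p / T)^-1, Th; split.
- move=> s; rewrite -{1}[s]FTh.
  have := dF (Th s) => ds.
  have -> : (p / T)^-1 * g (Th s) = ((p / T) * (g (Th s))^-1)^-1.
    by rewrite [RHS]invfM [in RHS]invrK.
  apply: (@is_derive_inverse R F Th) => //.
  + by apply: (@filterE _ (nbhs (Th s))) => z; exact: ThF.
  + by apply: (@filterE _ (nbhs (Th s))) => z; exact: cF.
  + by rewrite mulf_neq0// ?invr_eq0 gt_eqF.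
- by move=> s; apply: injF; rewrite Fp !FTh.
- exact: can_inj FTh.
- by move=> y; exists (F y).
Unshelve. all: by end_near. Qed.

(** The product [N t * expR (- K * t)] starts at zero and has a nonpositive derivative. *)
Lemma gronwall_nonneg (R : realType) (N n : R -> R) (K : R) :
  (forall s : R, is_derive s 1 N (n s)) -> (forall s, n s <= K * N s) ->
  N 0 = 0 -> forall s, 0 <= s -> N s <= 0.
Proof.
move=> dN nK N0 s s0.
pose M t := N t * expR (- K * t).
have dM (t : R) : is_derive t 1 M ((n t - K * N t) * expR (- K * t)).
  have d1 := dN t.
  have d2 : is_derive t 1 (fun t => expR (- K * t)) (expR (- K * t) * - K).
    have -> : (fun t => expR (- K * t)) = expR \o ( *%R (- K)) by [].
    apply: is_derive1_comp.
    rewrite -[X in is_derive _ _ _ X]mulr1; exact: is_deriveZ.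
  have -> : (n t - K * N t) * expR (- K * t) =
     N t *: (expR (- K * t) * - K) + expR (- K * t) *: n t.
    by rewrite /GRing.scale/=; ring.
  exact: is_deriveM.
have [|c _] := @MVT_segment R M _ 0 s s0 (fun t _ => dM t).
  apply: continuous_subspaceT => t.
  apply/differentiable_continuous/derivable1_diffP.
  by have := dM t => dt; exact: ex_derive.
rewrite /M N0 mul0r !subr0 => e.
have : N s * expR (- K * s) <= 0.
  rewrite e mulr_le0_ge0// mulr_le0_ge0 ?expR_ge0//.
  by rewrite subr_le0.
by rewrite pmulr_lle0// expR_gt0.
Qed.

(** The bound on the absolute value survives time reversal, which reduces negative times to positive
    ones. *)
Lemma gronwall_zero (R : realType) (N n : R -> R) (K : R) :
  (forall s : R, is_derive s 1 N (n s)) -> (forall s, `|n s| <= K * N s) ->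
  N 0 = 0 -> forall s, N s <= 0.
Proof.
move=> dN nK N0 s; have [s0|/ltW s0] := leP 0 s.
  apply: (@gronwall_nonneg R N n K) => // t.
  by rewrite (le_trans (ler_norm _)).
rewrite -[s]opprK; apply: (@gronwall_nonneg R (N \o -%R) (fun t => - n (- t)) K).
- move=> t; rewrite -mulrN1; have := dN (- t) => dt.
  exact: is_derive1_comp.
- by move=> t; rewrite (le_trans (ler_norm _))// normrN.
- by rewrite /= oppr0.
- by rewrite oppr_ge0.
Qed.

(** Gronwall for the squared distance of the two solutions, whose derivative is twice the inner
    product bounded in the hypothesis. *)
Lemma planar_ode_unique (R : realType) (u1 u2 v1 v2 a1 a2 b1 b2 : R -> R) (K : R) :
  (forall s : R, is_derive s 1 u1 (a1 s)) -> (forall s : R, is_derive s 1 u2 (a2 s)) ->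
  (forall s : R, is_derive s 1 v1 (b1 s)) -> (forall s : R, is_derive s 1 v2 (b2 s)) ->
  (forall s, `|(u1 s - v1 s) * (a1 s - b1 s) + (u2 s - v2 s) * (a2 s - b2 s)|
     <= K * ((u1 s - v1 s) ^+ 2 + (u2 s - v2 s) ^+ 2)) ->
  u1 0 = v1 0 -> u2 0 = v2 0 -> forall s, u1 s = v1 s /\ u2 s = v2 s.
Proof.
move=> du1 du2 dv1 dv2 HK e1 e2 s.
pose N t := (u1 t - v1 t) ^+ 2 + (u2 t - v2 t) ^+ 2.
have : N s <= 0.
  apply: (@gronwall_zero R N (fun s => 2 * ((u1 s - v1 s) * (a1 s - b1 s)
      + (u2 s - v2 s) * (a2 s - b2 s))) (2 * K)).
  - move=> t; have h1 := du1 t; have h2 := du2 t; have h3 := dv1 t.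
    have h4 := dv2 t.
    apply: is_derive_eq.
    by rewrite /GRing.scale/=; ring.
  - by move=> t; rewrite normrM ger0_norm// -mulrA ler_wpM2l// HK.
  - by rewrite /N e1 e2 !subrr expr0n addr0.
move=> N0; have [] : (u1 s - v1 s) ^+ 2 = 0 /\ (u2 s - v2 s) ^+ 2 = 0.
  have := sqr_ge0 (u1 s - v1 s); have := sqr_ge0 (u2 s - v2 s).
  by move: N0; rewrite /N; split; lra.
move=> /eqP; rewrite sqrf_eq0 subr_eq0 => /eqP-> /eqP.
by rewrite sqrf_eq0 subr_eq0 => /eqP->.
Qed.

(** * The level curves *)

(** A negative product covers both orders of signs and keeps the root away from the end-points. *)
Lemma poly_ivt_oo (R : rcfType) (p : {poly R}) (a b : R) :
  a <= b -> p.[a] * p.[b] < 0 -> exists2 x, a < x < b & p.[x] = 0.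
Proof.
move=> ab pab.
have [x xab px] : exists2 x, a <= x <= b & p.[x] = 0.
  have [pa|pa] := leP p.[a] 0.
    have pb : 0 <= p.[b] by rewrite leNgt; apply/negP => pb; nra.
    by have [|x ? /rootP] := @poly_ivt R p a b ab; [rewrite pa pb|exists x].
  have pb : p.[b] <= 0 by rewrite leNgt; apply/negP => pb; nra.
  have [|x ? /rootP] := @poly_ivt R (- p) a b ab.
    by rewrite !hornerN oppr_le0 oppr_ge0 (ltW pa) pb.
  by rewrite hornerN => /eqP; rewrite oppr_eq0 => /eqP; exists x.
exists x => //; case/andP: xab => ax xb.
apply/andP; split; rewrite lt_neqAle ?ax ?xb andbT.
  by apply: contraTneq pab => ->; rewrite px mul0r ltxx.
by apply: contraTneq pab => <-; rewrite px mulr0 ltxx.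
Qed.

(** Sign changes give three roots, and the positive leading coefficient gives a fourth beyond [t3];
    four distinct roots factor a quartic. If [q t0] is zero then [t0] itself is taken as the first
    root, whence the half-closed interval. *)
Lemma quartic_factor (R : rcfType) (q : R -> R)
    (c4 c3 c2 c1 c0 t0 t1 t2 t3 : R) :
  (forall x, q x = c4 * x ^+ 4 + c3 * x ^+ 3 + c2 * x ^+ 2 + c1 * x + c0) ->
  0 < c4 -> t0 < t1 -> t1 < t2 -> t2 < t3 ->
  0 <= q t0 -> q t1 < 0 -> 0 < q t2 -> q t3 < 0 ->
  exists x0 x1 x2 x3,
    [/\ t0 <= x0 < t1, t1 < x1 < t2, t2 < x2 < t3, t3 < x3 &
      forall x, q x = c4 * (x - x0) * (x - x1) * (x - x2) * (x - x3)].
Proof.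
move=> qE c40 t01 t12 t23 q0 q1 q2 q3.
pose s := [:: c0; c1; c2; c3; c4]; pose p := Poly s.
have ps : p = s :> seq R by rewrite (@PolyK _ 0)//= gt_eqF.
have pE x : p.[x] = q x by rewrite horner_Poly/= qE; ring.
have lp : lead_coef p = c4 by rewrite /lead_coef ps.
have [x0 /andP[t0x0 x0t1] px0] : exists2 x, t0 <= x < t1 & p.[x] = 0.
  have [e|e] := eqVneq (q t0) 0; first by exists t0; rewrite ?lexx ?t01// pE.
  have [|x /andP[a b] px] := @poly_ivt_oo R p _ _ (ltW t01).
    by rewrite !pE pmulr_rlt0// lt_neqAle eq_sym e.
  by exists x; rewrite ?(ltW a).
have [|x1 x1t px1] := @poly_ivt_oo R p _ _ (ltW t12).
  by rewrite !pE nmulr_rlt0.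
have [|x2 x2t px2] := @poly_ivt_oo R p _ _ (ltW t23).
  by rewrite !pE pmulr_rlt0.
have [n Hn] := @polyrcf.poly_pinfty_gt_lc R p (eq_rect_r (fun x => 0 < x) c40 lp).
pose t4 := Num.max t3 n.
have t34 : t3 <= t4 by rewrite le_max lexx.
have [|x3 x3t px3] := @poly_ivt_oo R p _ _ t34.
  rewrite (pE t3) nmulr_rlt0//.
  by rewrite (lt_le_trans _ (Hn t4 _)) ?lp// le_max lexx orbT.
exists x0, x1, x2, x3.
move/andP: (x1t) => [? ?]; move/andP: (x2t) => [? ?]; move/andP: (x3t) => [? ?].
split=> //; first by rewrite t0x0.
move=> x; rewrite -pE (@all_roots_prod_XsubC R p [:: x0; x1; x2; x3]).
- by rewrite lp !big_cons big_nil !hornerE/=; ring.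
- by rewrite ps.
- by rewrite /= !rootE px0 px1 px2 px3 eqxx.
- have h1 : x0 < x1 by lra.
  have h2 : x1 < x2 by lra.
  have h3 : x2 < x3 by lra.
  rewrite uniq_rootsE /= !inE !negb_or !lt_eqF//; lra.
Qed.

(** * The cubic as a quadratic in [y], and the roots of its discriminant *)

Section LevelCurve.
Context {R : realType} (al be ga de ep ze et h : R).

Definition cubA x := be * x + de.
Definition cubB x := al * x ^+ 2 - h * x + ze.
Definition cubC x := ga * x ^+ 2 + ep * x + et.
(* [x * y * (V - h)], as a quadratic polynomial in [y]. *)
Definition cubic x y := cubA x * y ^+ 2 + cubB x * y + cubC x.

Definition oval_roots x0 x1 x2 x3 :=
  [/\ [/\ 0 <= x0, x0 < x1, x1 < x2 & x2 < x3],
      forall x, cubB x ^+ 2 - 4 * cubA x * cubC x =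
        al ^+ 2 * ((x - x0) * (x3 - x)) * ((x - x1) * (x2 - x)),
      forall x, x1 <= x <= x2 -> cubB x < 0 &
      forall x y, 0 < x -> 0 < y -> cubic x y <= 0 -> x1 <= x <= x2].

Hypotheses (al0 : 0 < al) (be0 : 0 < be) (ga0 : 0 < ga) (de0 : 0 < de)
  (ep0 : 0 < ep) (ze0 : 0 < ze) (et0 : 0 < et) (dis0 : 4 * de * et <= ze ^+ 2).

Lemma cubA_gt0 x : 0 <= x -> 0 < cubA x.
Proof. by move=> x0; rewrite /cubA ltr_wpDl// mulr_ge0// ltW. Qed.

Lemma cubC_gt0 x : 0 <= x -> 0 < cubC x.
Proof.
by move=> x0; rewrite /cubC ltr_wpDl// addr_ge0// mulr_ge0 ?sqr_ge0// ltW.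
Qed.

Lemma cubB_lt0 x y : 0 < x -> 0 < y -> cubic x y <= 0 -> cubB x < 0.
Proof.
rewrite /cubic => x0 y0 Q0.
have A0 := cubA_gt0 (ltW x0); have C0 := cubC_gt0 (ltW x0).
have Ay : 0 <= cubA x * y ^+ 2 by rewrite mulr_ge0 ?sqr_ge0// ltW.
by rewrite -(pmulr_llt0 _ y0); lra.
Qed.

(** Completing the square in [y]: where [cubA] is positive and [cubic] is at most zero, the
    discriminant is nonnegative. *)
Lemma cubic_sqr x y : 4 * cubA x * cubic x y =
  (2 * cubA x * y + cubB x) ^+ 2 - (cubB x ^+ 2 - 4 * cubA x * cubC x).
Proof. by rewrite /cubic; ring. Qed.

(** The discriminant [D] is nonnegative at 0 by [dis0], negative at the two zeros [b1 < b2] of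
    [cubB], and positive at [px], which lies between them. These are the signs that [quartic_factor]
    needs. *)
Lemma oval_rootsP px py : 0 < px -> 0 < py -> cubic px py < 0 ->
  exists x0 x1 x2 x3, oval_roots x0 x1 x2 x3.
Proof.
move=> px0 py0 Qp; have Bp := cubB_lt0 px0 py0 (ltW Qp).
pose D x := cubB x ^+ 2 - 4 * cubA x * cubC x.
have [b1 /andP[b10 b1p] Bb1] : exists2 x, 0 < x < px & cubB x = 0.
  have pE x : (Poly [:: ze; - h; al]).[x] = cubB x.
    by rewrite horner_Poly/= /cubB; ring.
  have [|x xp] := @poly_ivt_oo R (Poly [:: ze; - h; al]) _ _ (ltW px0).
    by rewrite !pE pmulr_rlt0// /cubB expr0n/= !mulr0 subr0 add0r.
  by rewrite pE; exists x.
(* The other zero of [cubB], from the sum of the roots. *)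
pose b2 := h / al - b1.
have BE x : cubB x = al * (x - b1) * (x - b2).
  by rewrite -[LHS]subr0 -Bb1 /cubB /b2; field; rewrite gt_eqF.
have b2p : px < b2.
  rewrite -subr_lt0 -(pmulr_rlt0 _ al0) -(pmulr_llt0 _ (_ : 0 < px - b1)).
    by rewrite mulrAC -BE.
  by rewrite subr_gt0.
have Bb2 : cubB b2 = 0 by rewrite BE subrr mulr0.
have Db (b : R) : 0 < b -> cubB b = 0 -> D b < 0.
  move=> b0 Bb; rewrite /D Bb expr0n/= sub0r oppr_lt0.
  by rewrite !mulr_gt0// ?cubA_gt0 ?cubC_gt0 ?ltW.
have Dp : 0 < D px.
  have := cubic_sqr px py; rewrite -/(D px).
  have := cubA_gt0 (ltW px0) => A0; have := sqr_ge0 (2 * cubA px * py + cubB px).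
  move=> s0 e; have : 4 * cubA px * cubic px py < 0 by rewrite pmulr_rlt0// mulr_gt0.
  by lra.
have b20 : 0 < b2 by exact: lt_trans b2p.
have DE x : D x = al ^+ 2 * x ^+ 4 + (- 2 * al * h - 4 * be * ga) * x ^+ 3
    + (h ^+ 2 + 2 * al * ze - 4 * be * ep - 4 * de * ga) * x ^+ 2
    + (- 2 * h * ze - 4 * be * et - 4 * de * ep) * x + (ze ^+ 2 - 4 * de * et).
  by rewrite /D /cubA /cubB /cubC; ring.
have [||||x0 [x1 [x2 [x3 [/andP[x00 x0b] /andP[x1b x1p] /andP[x2p x2b] x3b Dfac]]]]] :=
  quartic_factor DE (exprn_gt0 2 al0) b10 b1p b2p.
- have -> : D 0 = ze ^+ 2 - 4 * de * et by rewrite /D /cubA /cubB /cubC; ring.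
  by rewrite subr_ge0.
- by rewrite Db.
- by [].
- by rewrite Db.
have Dx x : D x = al ^+ 2 * ((x - x0) * (x3 - x)) * ((x - x1) * (x2 - x)).
  by rewrite Dfac; ring.
exists x0, x1, x2, x3; split=> //.
- by split=> //; lra.
- move=> x /andP[h1 h2]; rewrite BE -mulrA pmulr_rlt0// pmulr_rlt0; lra.
(* [cubB x < 0] puts [x] between [b1] and [b2], where the outer factors of [D] are positive; then
   [0 <= D x] leaves only [[x1, x2]]. *)
- move=> x y xp yp Q0.
  have Bx : cubB x < 0 by apply: cubB_lt0 xp yp Q0.
  have /andP[b1x xb2] : b1 < x < b2.
    move: Bx; rewrite BE -mulrA pmulr_rlt0// => Bx.
    by apply/andP; split; rewrite ltNge; apply/negP => hh; nra.
  have Dx0 : 0 <= D x.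
    have := cubic_sqr x y; have := sqr_ge0 (2 * cubA x * y + cubB x).
    have : 4 * cubA x * cubic x y <= 0.
      by rewrite mulr_ge0_le0// mulr_ge0// ltW// cubA_gt0// ltW.
    by rewrite -/(D x); lra.
  have : 0 <= (x - x1) * (x2 - x).
    move: Dx0; rewrite Dx pmulr_rge0// !mulr_gt0 ?exprn_gt0//; lra.
  by move=> hh; apply/andP; split; rewrite leNgt; apply/negP => gg; nra.
Qed.

End LevelCurve.

Lemma elem_sub {R : realType} (U : set (R * R)) f g :
  elementary U f -> elementary U g -> elementary U (fun q => f q - g q).
Proof.
move=> ef eg; rewrite (_ : (fun q => _) = fun q => f q + (-1) * g q).
  by apply: elem_add => //; apply: elem_mul => //; exact: elem_cst.
by apply/funext => q; rewrite mulN1r.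
Qed.

Lemma elem_div {R : realType} (U : set (R * R)) f g :
  elementary U f -> elementary U g -> (forall q, U q -> g q != 0) ->
  elementary U (fun q => f q / g q).
Proof. by move=> ef eg g0; apply: elem_mul => //; exact: elem_inv. Qed.

Lemma elem_sqr {R : realType} (U : set (R * R)) f :
  elementary U f -> elementary U (fun q => f q ^+ 2).
Proof. by move=> ef; exact: (elem_mul ef ef). Qed.

Lemma elementary_continuous {R : realType} (f : R * R -> R) :
  elementary setT f -> continuous f.
Proof.
move=> /elementary_derive[df _] q; apply: differentiable_continuous.
exact: df.
Qed.

Lemma open_elementary_gt0 {R : realType} (f : R * R -> R) :
  elementary setT f -> open [set q | 0 < f q].
Proof.
move=> /elementary_continuous cf.
by apply: (@open_comp _ _ f [set y | y > 0]) => [q _|]; [exact: cf|exact: open_gt].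
Qed.

Lemma closed_elementary_le0 {R : realType} (f : R * R -> R) :
  elementary setT f -> closed [set q | f q <= 0].
Proof.
move=> /elementary_continuous/continuous_closedP/(_ [set y | y <= 0]).
by apply; exact: closed_le.
Qed.

(** The trace of [O] on the component is nonempty, open and closed, hence everything. For the oval,
    [O] is its open inside and [C] the closed region, which agree off the curve. *)
Lemma component_sub_clopen (T : topologicalType) (S O C : set T) (p : T) :
  S p -> O p -> open O -> closed C -> S `&` O = S `&` C ->
  connected_component S p `<=` O.
Proof.
move=> Sp Op oO cC SOC; set K := connected_component S p.
have KS : K `<=` S by exact: connected_component_sub.
have Kp : K p by exact: connected_component_refl.
have KOC : K `&` O = K `&` C.
  by rewrite -[K](setIidl KS) -!setIA SOC.
have e : K `&` O = K.
  apply: (@component_connected _ S p); first by exists p.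
  - by exists O.
  - by exists C.
by move=> q Kq; have : (K `&` O) q by [rewrite e]; case.
Qed.

(** * The oval: diffeomorphism with the circle, bounds, and the points it surrounds *)

Section Oval.
Context {R : realType} (al be ga de ep ze et h : R).
Hypotheses (al0 : 0 < al) (be0 : 0 < be) (ga0 : 0 < ga) (de0 : 0 < de)
  (ep0 : 0 < ep) (ze0 : 0 < ze) (et0 : 0 < et).

Local Notation cA := (cubA be de).
Local Notation cB := (cubB al ze h).
Local Notation cC := (cubC ga ep et).
Local Notation Q := (cubic al be ga de ep ze et h).

Definition oval : set (R * R) := [set q | [/\ 0 < q.1, 0 < q.2 & Q q.1 q.2 = 0]].

Context (x0 x1 x2 x3 : R).
Hypothesis Hroots : oval_roots al be ga de ep ze et h x0 x1 x2 x3.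

Let cA_gt0 x : 0 <= x -> 0 < cA x. Proof. exact: cubA_gt0. Qed.
Let cC_gt0 x : 0 <= x -> 0 < cC x. Proof. exact: cubC_gt0. Qed.

(** The discriminant without its inner roots. It does not vanish at [x1] and [x2], so its square
    root is smooth along the whole curve. *)
Definition oval_dd x := al ^+ 2 * ((x - x0) * (x3 - x)).
Definition oval_mid := (x1 + x2) / 2.
Definition oval_rad := (x2 - x1) / 2.
Local Notation dd := oval_dd.
Local Notation m := oval_mid.
Local Notation r := oval_rad.

Lemma oval_rad_gt0 : 0 < r.
Proof. by have [[*]] := Hroots; rewrite divr_gt0// subr_gt0. Qed.

Lemma oval_dd_gt0 x : x0 < x < x3 -> 0 < dd x.
Proof.
by move=> /andP[a b]; rewrite !mulr_gt0 ?exprn_gt0// subr_gt0.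
Qed.

Lemma oval_discr x : cB x ^+ 2 - 4 * cA x * cC x = dd x * ((x - x1) * (x2 - x)).
Proof. by have [_ -> _ _] := Hroots. Qed.

Lemma oval_midE x : (x - x1) * (x2 - x) = r ^+ 2 - (x - m) ^+ 2.
Proof. by rewrite /oval_rad /oval_mid; field. Qed.

Definition to_circle (q : R * R) : R * R :=
  ((q.1 - m) / r, (2 * cA q.1 * q.2 + cB q.1) / (r * Num.sqrt (dd q.1))).

Definition of_circle (z : R * R) : R * R :=
  (m + r * z.1,
   (r * z.2 * Num.sqrt (dd (m + r * z.1)) - cB (m + r * z.1))
     / (2 * cA (m + r * z.1))).

Lemma oval_x q : oval q -> x1 <= q.1 <= x2.
Proof.
have [_ _ _ H] := Hroots; case: q => x y [/= xp yp e].
by apply: H yp _ => //; rewrite e.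
Qed.

Lemma itv_x x : x1 <= x <= x2 -> x0 < x < x3 /\ 0 <= x.
Proof.
have [[h0 h1 h2 h3] _ _ _] := Hroots => /andP[a b]; split; last lra.
by apply/andP; split; lra.
Qed.

(** The equation reads [cubB x * y = - (cubA x * y ^+ 2 + cubC x)], with negative right side and
    [cubB x < 0]. *)
Lemma oval_y x y : x1 <= x <= x2 -> Q x y = 0 -> 0 < y.
Proof.
move=> xI Qxy; have [_ x_ge0] := itv_x xI.
have [_ _ HB _] := Hroots; have B0 := HB x xI.
have A0 := cA_gt0 x_ge0; have C0 := cC_gt0 x_ge0.
rewrite -(nmulr_rlt0 _ B0).
have : 0 <= cA x * y ^+ 2 by rewrite mulr_ge0 ?sqr_ge0// ltW.
by move: Qxy; rewrite /cubic; lra.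
Qed.

Lemma circle_x z : unit_circle z -> x1 <= m + r * z.1 <= x2.
Proof.
rewrite /unit_circle/= => z1; have r0 := oval_rad_gt0.
have : -1 <= z.1 <= 1 by apply/andP; split; nra.
move=> /andP[a b].
have -> : x1 = m - r by rewrite /oval_mid /oval_rad; field.
have -> : x2 = m + r by rewrite /oval_mid /oval_rad; field.
by apply/andP; split; nra.
Qed.

Lemma of_circle_w z : x1 <= m + r * z.1 <= x2 ->
  2 * cA (of_circle z).1 * (of_circle z).2 + cB (of_circle z).1 =
  r * z.2 * Num.sqrt (dd (m + r * z.1)).
Proof.
move=> /itv_x[_ /cA_gt0 A0]; rewrite /of_circle/=; field.
by rewrite gt_eqF.
Qed.

Lemma of_circle_oval z : unit_circle z -> oval (of_circle z).
Proof.
move=> uz; have xI := circle_x uz; have [xx x_ge0] := itv_x xI.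
have dd0 := oval_dd_gt0 xx.
have QE : Q (of_circle z).1 (of_circle z).2 = 0.
  have A0 : 0 < cA (of_circle z).1 by exact: cA_gt0.
  (* After multiplication by [4 * cubA], the completed square applies and the claim becomes the
     equation of the circle. *)
  apply: (@mulfI _ (4 * cA (of_circle z).1)); first by rewrite mulf_neq0// gt_eqF.
  rewrite mulr0 cubic_sqr of_circle_w// oval_discr oval_midE /=.
  rewrite exprMn sqr_sqrtr; last exact: ltW.
  have e2 : z.2 ^+ 2 = 1 - z.1 ^+ 2 by rewrite -uz addrC addKr.
  by rewrite exprMn e2; ring.
have [[h0 h1 h2 h3] _ _ _] := Hroots.
split=> //; last exact: oval_y QE.
by case/andP: xI => a _; rewrite /=; lra.
Qed.

Lemma to_circle_circle q : oval q -> unit_circle (to_circle q).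
Proof.
move=> Oq; have xI := oval_x Oq; have [xx _] := itv_x xI.
have dd0 := oval_dd_gt0 xx; have r0 := oval_rad_gt0; have [_ _ QE] := Oq.
rewrite /unit_circle/= expr_div_n [X in _ + X]expr_div_n.
rewrite (exprMn 2 r (Num.sqrt _)) sqr_sqrtr; last exact: ltW.
have := cubic_sqr al be ga de ep ze et h q.1 q.2.
rewrite QE mulr0 oval_discr oval_midE => /esym/subr0_eq ->.
by field; rewrite !gt_eqF.
Qed.

Lemma oval_mutually_inverse : mutually_inverse oval unit_circle to_circle of_circle.
Proof.
have r0 := oval_rad_gt0.
split.
- exact: to_circle_circle.
- exact: of_circle_oval.
- move=> [x y] /set_mem Oq; have xI := oval_x Oq; have [xx /cA_gt0 A0] := itv_x xI.
  have s0 : 0 < Num.sqrt (dd x) by rewrite sqrtr_gt0 oval_dd_gt0.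
  rewrite /to_circle /of_circle/=.
  have -> : m + r * ((x - m) / r) = x by field; rewrite gt_eqF.
  congr (_, _); rewrite /= in s0 A0; field; rewrite !gt_eqF//.
- move=> z /set_mem uz; have xI := circle_x uz; have [xx x_ge0] := itv_x xI.
  have s0 : 0 < Num.sqrt (dd (m + r * z.1)) by rewrite sqrtr_gt0 oval_dd_gt0.
  rewrite /to_circle of_circle_w//= [RHS]surjective_pairing; congr (_, _).
    by field; rewrite gt_eqF.
  by field; rewrite !gt_eqF.
Qed.

Lemma elem_cubA U f : elementary U f -> elementary U (fun q : R * R => cA (f q)).
Proof.
by move=> ef; apply: elem_add; [apply: elem_mul => //|]; exact: elem_cst.
Qed.

Lemma elem_cubB U f : elementary U f -> elementary U (fun q : R * R => cB (f q)).
Proof.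
move=> ef; apply: elem_add; last exact: elem_cst.
by apply: elem_sub; apply: elem_mul => //; try exact: elem_cst; exact: elem_sqr.
Qed.

Lemma elem_cubC U f : elementary U f -> elementary U (fun q : R * R => cC (f q)).
Proof.
move=> ef; apply: elem_add; last exact: elem_cst.
by apply: elem_add; apply: elem_mul => //; try exact: elem_cst; exact: elem_sqr.
Qed.

Lemma elem_cubic U : elementary U (fun q : R * R => Q q.1 q.2).
Proof.
have ef := elem_fst U; have es := elem_snd U.
apply: elem_add; last exact: elem_cubC.
apply: elem_add; apply: elem_mul => //.
- exact: elem_cubA.
- exact: elem_sqr.
- exact: elem_cubB.
Qed.

Lemma elem_dd U f : elementary U f -> elementary U (fun q : R * R => dd (f q)).
Proof.
move=> ef; apply: elem_mul; first exact: elem_cst.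
by apply: elem_mul; apply: elem_sub => //; exact: elem_cst.
Qed.

(** Both maps are elementary on the open strip where the abscissa lies in []x0, x3[]: there
    [oval_dd] is positive, and [cubA] is positive because [0 <= x0]. *)
Lemma oval_diffeomorphic : diffeomorphic oval unit_circle.
Proof.
exists to_circle, of_circle; have r0 := oval_rad_gt0; split.
- exact: oval_mutually_inverse.
- pose U : set (R * R) := [set q | 0 < q.1 - x0] `&` [set q | 0 < x3 - q.1].
  have UP q : U q -> x0 < q.1 < x3 by move=> []; rewrite /= !subr_gt0 => -> ->.
  have ef := elem_fst U; have es := elem_snd U.
  apply: (@elementary_smooth_on _ U).
  + apply: openI; apply: open_elementary_gt0; apply: elem_sub;
      by [exact: elem_fst|exact: elem_cst].
  + move=> q Oq; have [/andP[a b] _] := itv_x (oval_x Oq).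
    by split; rewrite /= subr_gt0.
  + apply: elem_mul; last exact: elem_cst.
    by apply: elem_sub => //; exact: elem_cst.
  + apply: elem_div.
    * apply: elem_add; last exact: elem_cubB.
      apply: elem_mul => //; apply: elem_mul; first exact: elem_cst.
      exact: elem_cubA.
    * apply: elem_mul; first exact: elem_cst.
      apply: elem_sqrt; first exact: elem_dd.
      by move=> q /UP; exact: oval_dd_gt0.
    * move=> q /UP xx; rewrite gt_eqF// mulr_gt0// sqrtr_gt0.
      exact: oval_dd_gt0.
- have ex U : elementary U (fun z : R * R => m + r * z.1).
    apply: elem_add; first exact: elem_cst.
    by apply: elem_mul; [exact: elem_cst|exact: elem_fst].
  pose U : set (R * R) := [set z | 0 < (m + r * z.1) - x0] `&`
     [set z | 0 < x3 - (m + r * z.1)].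
  have UP z : U z -> x0 < m + r * z.1 < x3.
    by move=> []; rewrite /= !subr_gt0 => -> ->.
  have [[x00 _ _ _] _ _ _] := Hroots.
  apply: (@elementary_smooth_on _ U) => //.
  + apply: openI; apply: open_elementary_gt0; apply: elem_sub => //;
      exact: elem_cst.
  + move=> z /circle_x/itv_x[/andP[a b] _].
    by split; rewrite /= subr_gt0.
  + apply: elem_div.
    * apply: elem_sub; last exact: elem_cubB.
      apply: elem_mul.
        by apply: elem_mul; [exact: elem_cst|exact: elem_snd].
      apply: elem_sqrt; first exact: elem_dd.
      by move=> q /UP; exact: oval_dd_gt0.
    * by apply: elem_mul; [exact: elem_cst|exact: elem_cubA].
    * move=> q /UP /andP[a _]; rewrite gt_eqF// mulr_gt0// cA_gt0//; lra.
Qed.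

(** From [Q x y <= 0] and [0 < cubC x] follows [cubA x * y < - cubB x], while [de <= cubA x] and
    [- cubB x < |h| * x2]. *)
Lemma oval_bound : exists2 M, 0 < M &
  forall x y, x1 <= x <= x2 -> Q x y <= 0 -> [/\ 0 < x, x <= M, 0 < y & y <= M].
Proof.
have [[h0 h1 h2 h3] _ HB _] := Hroots; have x20 : 0 < x2 by lra.
have M0 : 0 <= `|h| * x2 / de by rewrite divr_ge0 ?mulr_ge0// ltW.
exists (x2 + `|h| * x2 / de); first by rewrite ltr_pwDl.
move=> x y xI Qxy; have [_ x_ge0] := itv_x xI; have B0 := HB x xI.
have A0 := cA_gt0 x_ge0; have C0 := cC_gt0 x_ge0.
have Ay : 0 <= cA x * y ^+ 2 by rewrite mulr_ge0 ?sqr_ge0// ltW.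
have y0 : 0 < y by rewrite -(nmulr_rlt0 _ B0); move: Qxy; rewrite /cubic; lra.
case/andP: xI => xa xb; split=> //; [lra|lra|].
suff : y <= `|h| * x2 / de by lra.
rewrite ler_pdivlMr//.
have AB : cA x * y + cB x < 0.
  rewrite -(pmulr_rlt0 _ y0); move: Qxy; rewrite /cubic => Qxy.
  have -> : y * (cA x * y + cB x) = cA x * y ^+ 2 + cB x * y by ring.
  by lra.
have hx : h * x <= `|h| * x2.
  apply: (@le_trans _ _ (`|h| * x)).
    by rewrite ler_wpM2r// ler_norm.
  by rewrite ler_wpM2l.
have b0 : 0 <= be * x * y by rewrite !mulr_ge0// ltW.
have a0 : 0 <= al * x ^+ 2 by rewrite mulr_ge0 ?sqr_ge0// ltW.
have e1 : cA x * y = be * x * y + y * de by rewrite /cubA; ring.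
have : - cB x < `|h| * x2 by move: hx ze0; rewrite /cubB; lra.
by lra.
Qed.

(** Off the oval, the open set [O] and the closed set [C] coincide, so the component of [p] stays in
    [O], which [oval_bound] makes bounded. *)
Lemma oval_surrounds p : 0 < p.1 -> 0 < p.2 -> Q p.1 p.2 < 0 -> surrounds oval p.
Proof.
move=> p1 p2 Qp; have Sp : (~` oval) p.
  by move=> [_ _ e]; rewrite e ltxx in Qp.
split=> //.
pose O : set (R * R) := [set q | 0 < q.1 - x1] `&` [set q | 0 < x2 - q.1]
  `&` [set q | 0 < 0 - Q q.1 q.2].
pose C : set (R * R) := [set q | x1 - q.1 <= 0] `&` [set q | q.1 - x2 <= 0]
  `&` [set q | Q q.1 q.2 <= 0].
have [_ _ _ HQ] := Hroots.
(* If [Q < 0], completing the square makes the discriminant positive, which excludes [x1] and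
   [x2]. *)
have strict q : x1 <= q.1 <= x2 -> Q q.1 q.2 < 0 -> O q.
  move=> xI Qq; have [xx /cA_gt0 A0] := itv_x xI; have dd0 := oval_dd_gt0 xx.
  have : 0 < (q.1 - x1) * (x2 - q.1).
    rewrite -(pmulr_rgt0 _ dd0) -oval_discr.
    have := cubic_sqr al be ga de ep ze et h q.1 q.2.
    have := sqr_ge0 (2 * cA q.1 * q.2 + cB q.1).
    have : 4 * cA q.1 * Q q.1 q.2 < 0 by rewrite pmulr_rlt0// mulr_gt0.
    by lra.
  case/andP: xI => a b hh.
  have ne : q.1 - x1 != 0 by apply: contraTneq hh => ->; rewrite mul0r ltxx.
  have ne2 : x2 - q.1 != 0 by apply: contraTneq hh => ->; rewrite mulr0 ltxx.
  split; [split|]; rewrite /=.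
  - by rewrite lt_neqAle eq_sym ne subr_ge0.
  - by rewrite lt_neqAle eq_sym ne2 subr_ge0.
  - by rewrite subr_gt0.
have Op : O p by apply: strict => //; apply: HQ p2 _ => //; exact: ltW.
have ef := elem_fst (R := R) setT.
have oO : open O.
  apply: openI; first apply: openI; apply: open_elementary_gt0; apply: elem_sub;
    by [exact: elem_fst|exact: elem_cst|exact: elem_cubic].
have cC' : closed C.
  apply: closedI; first apply: closedI; apply: closed_elementary_le0.
  - by apply: elem_sub; [exact: elem_cst|exact: elem_fst].
  - by apply: elem_sub; [exact: elem_fst|exact: elem_cst].
  - exact: elem_cubic.
have SOC : (~` oval) `&` O = (~` oval) `&` C.
  apply/seteqP; split=> q [Sq]; rewrite /O/C/=.
    by move=> [[a b] c]; split=> //; do ?split; rewrite /=; lra.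
  move=> [[a b] c]; split=> //; have xI : x1 <= q.1 <= x2 by apply/andP; split; lra.
  apply: strict => //; rewrite lt_neqAle c andbT; apply/eqP => e; apply: Sq.
  have [[h0 h1 h2 h3] _ _ _] := Hroots.
  by split=> //; [case/andP: xI; lra|exact: oval_y xI e].
have sub := component_sub_clopen Sp Op oO cC' SOC.
have [M M0 HM] := oval_bound.
exists M; split; first exact: num_real.
move=> M' MM' q /sub[[/= a b] c].
have [||u1 u2 u3 u4] := HM q.1 q.2; [by apply/andP; split; lra|by lra|].
apply: le_trans (ltW MM').
by rewrite prod_normE/= ge_max !gtr0_norm// u2 u4.
Qed.

End Oval.

(** * The Hamiltonian flow on a level curve *)

Section Flow.
Context {R : realType} (al be ga de ep ze et h : R).
Hypotheses (al0 : 0 < al) (be0 : 0 < be) (ga0 : 0 < ga) (de0 : 0 < de)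
  (ep0 : 0 < ep) (ze0 : 0 < ze) (et0 : 0 < et).

Local Notation cA := (cubA be de).
Local Notation cB := (cubB al ze h).
Local Notation cC := (cubC ga ep et).
Local Notation Q := (cubic al be ga de ep ze et h).
Local Notation oval := (oval al be ga de ep ze et h).

Definition cubic_dx x y := be * y ^+ 2 + (2 * al * x - h) * y + 2 * ga * x + ep.
Definition cubic_dy x y := 2 * cA x * y + cB x.

(* [w] rescales time so that the period is 2 pi. *)
Definition oval_flow w (u : R -> R * R) := forall s : R,
  [/\ oval (u s),
      is_derive s 1 (fun t => (u t).1) (w * - cubic_dy (u s).1 (u s).2) &
      is_derive s 1 (fun t => (u t).2) (w * cubic_dx (u s).1 (u s).2)].

Context (x0 x1 x2 x3 : R).
Hypothesis Hroots : oval_roots al be ga de ep ze et h x0 x1 x2 x3.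

Local Notation dd := (oval_dd al x0 x3).
Local Notation m := (oval_mid x1 x2).
Local Notation r := (oval_rad x1 x2).
Local Notation of_circle := (of_circle al be de ze h x0 x1 x2 x3).

Lemma oval_flow_shift w u tau :
  oval_flow w u -> oval_flow w (fun s => u (s + tau)).
Proof.
move=> Hu s; have [Ou d1 d2] := Hu (s + tau).
have ds : is_derive s 1 (fun s : R => s + tau) 1.
  by rewrite -[X in is_derive _ _ _ X]addr0; apply: is_deriveD.
split=> //.
  rewrite -[X in is_derive _ _ _ X]mulr1.
  exact: (@is_derive1_comp _ (fun t => (u t).1) (fun s => s + tau)).
rewrite -[X in is_derive _ _ _ X]mulr1.
exact: (@is_derive1_comp _ (fun t => (u t).2) (fun s => s + tau)).
Qed.

(** Both solutions stay in a box of side [M], where the polynomial field is Lipschitz, so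
    [planar_ode_unique] applies. *)
Lemma oval_flow_unique w u v : oval_flow w u -> oval_flow w v ->
  u 0 = v 0 -> u =1 v.
Proof.
move=> Hu Hv e0 s.
have [M M0 HM] := oval_bound al0 be0 ga0 de0 ep0 ze0 et0 Hroots.
have OM q : oval q -> [/\ 0 < q.1, q.1 <= M, 0 < q.2 & q.2 <= M].
  move=> Oq; apply: HM (oval_x Hroots Oq) _; by case: Oq => _ _ ->.
(* A common bound for the three coefficients [k1], [k2], [k3] of the quadratic form below. *)
pose c := 2 * (al + be) * M + `|h| + 2 * (de + ga).
have [] := @planar_ode_unique R (fun t => (u t).1) (fun t => (u t).2)
  (fun t => (v t).1) (fun t => (v t).2)
  (fun t => w * - cubic_dy (u t).1 (u t).2) (fun t => w * cubic_dx (u t).1 (u t).2)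
  (fun t => w * - cubic_dy (v t).1 (v t).2) (fun t => w * cubic_dx (v t).1 (v t).2)
  (`|w| * (2 * c)) _ _ _ _ _ _ _ s.
- by move=> t; have [] := Hu t.
- by move=> t; have [] := Hu t.
- by move=> t; have [] := Hv t.
- by move=> t; have [] := Hv t.
- move=> t; have [/OM[a1 a2 a3 a4] _ _] := Hu t.
  have [/OM[b1 b2 b3 b4] _ _] := Hv t.
  move: (u t).1 (u t).2 (v t).1 (v t).2 a1 a2 a3 a4 b1 b2 b3 b4.
  move=> x y x' y' a1 a2 a3 a4 b1 b2 b3 b4.
  (* The inner product is a quadratic form in [x - x'] and [y - y']. The mixed product is at most
     the sum of the squares in absolute value, which yields the constant [2 * c]. *)
  have -> : (x - x') * (w * - cubic_dy x y - w * - cubic_dy x' y') +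
     (y - y') * (w * cubic_dx x y - w * cubic_dx x' y') =
     w * ((2 * al * y' + 2 * ga - (2 * be * x' + 2 * de)) * ((x - x') * (y - y'))
       - (2 * be * y + al * (x + x') - h) * (x - x') ^+ 2
       + (be * (y + y') + 2 * al * x - h) * (y - y') ^+ 2).
    by rewrite /cubic_dy /cubic_dx /cubA /cubB; ring.
  rewrite normrM -[leRHS]mulrA ler_wpM2l//.
  have hh : - `|h| <= h <= `|h| by rewrite -ler_norml.
  case/andP: hh => hh1 hh2.
  have pr (k z Z : R) : 0 < k -> 0 < z -> z <= Z -> 0 <= k * z <= k * Z.
    move=> k0 z0 zZ; apply/andP; split; first exact/ltW/mulr_gt0.
    by rewrite ler_wpM2l// ltW.
  have /andP[p1 p2] := pr _ _ _ al0 a1 a2; have /andP[p3 p4] := pr _ _ _ al0 b1 b2.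
  have /andP[p5 p6] := pr _ _ _ be0 b1 b2; have /andP[p7 p8] := pr _ _ _ be0 a3 a4.
  have /andP[p9 p10] := pr _ _ _ be0 b3 b4; have /andP[p11 p12] := pr _ _ _ al0 b3 b4.
  have bd (k X : R) : `|k| <= c -> `|k * X| <= c * `|X|.
    by move=> kc; rewrite normrM ler_wpM2r.
  have := ga0; have := de0; move=> q1 q2.
  have k1 : `|2 * al * y' + 2 * ga - (2 * be * x' + 2 * de)| <= c.
    by rewrite ler_norml /c; apply/andP; split; lra.
  have k2 : `|2 * be * y + al * (x + x') - h| <= c.
    by rewrite ler_norml /c; apply/andP; split; lra.
  have k3 : `|be * (y + y') + 2 * al * x - h| <= c.
    by rewrite ler_norml /c; apply/andP; split; lra.
  have c0 : 0 <= c by exact: le_trans k1.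
  have := bd _ ((x - x') * (y - y')) k1; have := bd _ ((x - x') ^+ 2) k2.
  have := bd _ ((y - y') ^+ 2) k3.
  rewrite !(ger0_norm (sqr_ge0 _)) => t3 t2 t1.
  have t4 : c * `|(x - x') * (y - y')| <= c * ((x - x') ^+ 2 + (y - y') ^+ 2).
    rewrite ler_wpM2l// ler_norml.
    have := sqr_ge0 (x - x' + (y - y')); have := sqr_ge0 (x - x' - (y - y')).
    have := sqr_ge0 (x - x'); have := sqr_ge0 (y - y'); rewrite sqrrD sqrrB.
    by move=> s1 s2 s3 s4; apply/andP; split; lra.
  rewrite (le_trans (ler_normD _ _))//.
  have := ler_normB ((2 * al * y' + 2 * ga - (2 * be * x' + 2 * de)) *
    ((x - x') * (y - y'))) ((2 * be * y + al * (x + x') - h) * (x - x') ^+ 2).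
  by lra.
- by rewrite e0.
- by rewrite e0.
by move=> e1 e2; rewrite [u s]surjective_pairing e1 e2 -surjective_pairing.
Qed.

(** Both sides are the derivative of the discriminant, computed from its definition and from its
    factorization. *)
Lemma oval_discr_derive x :
  2 * cB x * (2 * al * x - h) - 4 * be * cC x - 4 * cA x * (2 * ga * x + ep) =
  al ^+ 2 * (x3 - x - (x - x0)) * (r ^+ 2 - (x - m) ^+ 2) - dd x * (2 * (x - m)).
Proof.
have E : (fun x => cB x ^+ 2 - 4 * cA x * cC x) =
    (fun x => dd x * (r ^+ 2 - (x - m) ^+ 2)).
  by apply/funext => y; rewrite (oval_discr Hroots) oval_midE.
have dl : is_derive x 1 (fun x => cB x ^+ 2 - 4 * cA x * cC x)
  (2 * cB x * (2 * al * x - h) - 4 * be * cC x - 4 * cA x * (2 * ga * x + ep)).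
  rewrite /cubA /cubB /cubC; apply: is_derive_eq.
  by rewrite /GRing.scale/=; ring.
have dr : is_derive x 1 (fun x => dd x * (r ^+ 2 - (x - m) ^+ 2))
  (al ^+ 2 * (x3 - x - (x - x0)) * (r ^+ 2 - (x - m) ^+ 2) - dd x * (2 * (x - m))).
  rewrite /oval_dd; apply: is_derive_eq.
  by rewrite /GRing.scale/=; ring.
by rewrite -(derive_val (is_derive := dl)) E derive_val.
Qed.

(** In the angle, the flow is the scalar equation with speed [g]. The first component of the field
    is read off from [2 * cubA * y + cubB = r * sin * g]; the second comes from differentiating this
    identity. *)
Lemma oval_flow_exists : exists (w : R) (Th : R -> R),
  [/\ oval_flow w (fun s => of_circle (cos (Th s), sin (Th s))),
      forall s, Th (s + pi *+ 2) = Th s + pi *+ 2,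
      injective Th & forall y, exists x, Th x = y].
Proof.
pose g t := Num.sqrt (dd (m + r * cos t)).
have UC (t : R) : unit_circle (cos t, sin t) by rewrite /unit_circle/= cos2Dsin2.
have xI t : x1 <= m + r * cos t <= x2 by exact: (circle_x Hroots (UC t)).
have dd0 t : 0 < dd (m + r * cos t).
  by have [xx _] := itv_x Hroots (xI t); exact: oval_dd_gt0.
have cg : continuous g.
  move=> t; apply: continuous_comp; last exact: sqrt_continuous.
  apply/differentiable_continuous/derivable1_diffP.
  by rewrite /oval_dd; exact: ex_derive.
have g0 t : 0 < g t by rewrite sqrtr_gt0.
have gp : periodic g (pi *+ 2) by move=> t; rewrite /g cosD2pi.
have p0 : 0 < (pi : R) *+ 2 by rewrite pmulrn_lgt0// pi_gt0.
have [w [Th [dTh Thp Thi Ths]]] := periodic_ode p0 cg g0 gp.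
exists w, Th; split; [|exact: Thp|exact: Thi|exact: Ths] => s.
have O := of_circle_oval al0 be0 ga0 de0 ep0 et0 Hroots (UC (Th s)).
set u := fun s => of_circle (cos (Th s), sin (Th s)).
have dT := dTh s.
pose X t := m + r * cos (Th t).
have dX : is_derive s 1 X (- (r * sin (Th s)) * (w * g (Th s))).
  apply: is_derive_eq.
  by rewrite /GRing.scale/=; ring.
have W1 : cubic_dy (u s).1 (u s).2 = r * sin (Th s) * g (Th s).
  exact: (of_circle_w be0 de0 Hroots (z := (cos _, sin _)) (xI (Th s))).
split; first exact: O.
  apply: is_derive_eq.
  by rewrite W1; ring.
set S := g (Th s) in W1 dX dT.
(* The derivative of [oval_dd] at [X s]. *)
pose ddd := al ^+ 2 * (x3 - X s - (X s - x0)).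
have S0 : S != 0 by rewrite gt_eqF// /S g0.
have SS : S ^+ 2 = dd (X s) by rewrite /S /g sqr_sqrtr// ltW// dd0.
have dS : is_derive s 1 (fun t => Num.sqrt (dd (X t)))
    ((2 * S)^-1 * (ddd * (- (r * sin (Th s)) * (w * S)))).
  apply: (@is_derive1_comp _ Num.sqrt (fun t => dd (X t))).
    exact: (is_derive1_sqrt (dd0 (Th s))).
  rewrite /oval_dd /ddd; apply: is_derive_eq.
  by rewrite /GRing.scale/=; ring.
pose W' := w * (r * cos (Th s) * S ^+ 2 - (r * sin (Th s)) ^+ 2 * ddd / 2).
have dW : is_derive s 1 (fun t => r * sin (Th t) * Num.sqrt (dd (X t))) W'.
  apply: is_derive_eq; rewrite /GRing.scale/= -[Num.sqrt (dd (X s))]/S /W'.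
  by field.
have sc : (r * sin (Th s)) ^+ 2 = r ^+ 2 - (X s - m) ^+ 2.
  by rewrite exprMn sin2cos2 /X; ring.
(* Up to the factor [- w / 2], [W'] is the derivative of the discriminant at [X s]. *)
have W'E : W' = w * (- (2 * cB (X s) * (2 * al * X s - h) - 4 * be * cC (X s)
    - 4 * cA (X s) * (2 * ga * X s + ep)) / 2).
  by rewrite /W' sc SS oval_discr_derive /ddd /X; field.
have A0 : 0 < cA (X s) by apply: cubA_gt0 => //; have [_] := itv_x Hroots (xI (Th s)).
have dA : is_derive s 1 (fun t => (2 * cA (X t))^-1)
    (- (2 * cA (X s)) ^- 2 * (2 * (be * (- (r * sin (Th s)) * (w * S))))).
  apply: is_deriveV; first by rewrite mulf_neq0// gt_eqF.
  by rewrite /cubA; apply: is_derive_eq; rewrite /GRing.scale/=; ring.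
have dB : is_derive s 1 (fun t => cB (X t))
    ((2 * al * X s - h) * (- (r * sin (Th s)) * (w * S))).
  by rewrite /cubB; apply: is_derive_eq; rewrite /GRing.scale/=; ring.
have duu : is_derive s 1 (fun t => (u t).2)
  ((W' - (2 * al * X s - h) * (- (r * sin (Th s)) * (w * S))) * (2 * cA (X s))^-1
   + (r * sin (Th s) * S - cB (X s)) *
     (- (2 * cA (X s)) ^- 2 * (2 * (be * (- (r * sin (Th s)) * (w * S)))))).
  apply: is_derive_eq; rewrite /GRing.scale/= -[Num.sqrt (dd (X s))]/S.
  by ring.
apply: is_derive_eq duu _.
have [_ _ QE] := O; rewrite -/(u s) in QE.
have eW : r * sin (Th s) * S = cubic_dy (X s) (u s).2 by exact: (esym W1).
have eX : - (r * sin (Th s)) * (w * S) = - w * cubic_dy (X s) (u s).2.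
  by rewrite -eW; ring.
(* The curve equation eliminates [cubC]; what remains is a rational identity with denominator a
   power of [cubA]. *)
have eC : cC (X s) = - (cA (X s) * (u s).2 ^+ 2 + cB (X s) * (u s).2).
  by apply/eqP; rewrite -addr_eq0 addrC; apply/eqP.
rewrite eX eW W'E eC /cubic_dy /cubic_dx.
move: (cA (X s)) (cB (X s)) (u s).2 A0 => A B y A0.
have -> : (u s).1 = X s by [].
by field; rewrite gt_eqF.
Qed.

(** The orbit [G] covers the oval with the same fibres as the angle. [F] maps it to a solution
    starting at some [G tau'], hence to its time shift by [tau'], as [conjugate_of_param]
    requires. *)
Lemma oval_conjugate_to_rotation (F : R * R -> R * R) :
  (forall w u, oval_flow w u -> oval_flow w (F \o u)) ->
  conjugate_to_rotation oval F.
Proof.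
move=> HF.
have [w [Th [Hflow Thp Thi Ths]]] := oval_flow_exists.
pose G s := of_circle (cos (Th s), sin (Th s)).
have [toO ofC to_of of_to] :=
  oval_mutually_inverse al0 be0 ga0 de0 ep0 et0 Hroots.
have UC (t : R) : unit_circle (cos t, sin t) by rewrite /unit_circle/= cos2Dsin2.
have OG s : oval (G s) by have [] := Hflow s.
have Gp (s : R) (k : int) : G (s + k%:~R * (pi *+ 2)) = G s.
  rewrite /G (quasi_periodic_int Thp).
  by have [_] := circle_param_eq (Th s) (Th s + k%:~R * (pi *+ 2)); move=> <-//; exists k.
have fib s t : G s = G t <-> (cos s, sin s) = (cos t, sin t).
  rewrite circle_param_eq; split=> [e|[k ->]]; last by rewrite Gp.
  have : (cos (Th s), sin (Th s)) = (cos (Th t), sin (Th t)).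
    by rewrite -[LHS]of_to ?inE// -[RHS]of_to ?inE//; congr to_circle.
  move/circle_param_eq => [k ek]; exists k; apply: Thi.
  by rewrite (quasi_periodic_int Thp).
have sG q : oval q -> exists2 s, 0 <= s <= pi *+ 2 & G s = q.
  move=> Oq; have [t _ et'] := circle_param_surj (toO _ Oq).
  have [s es] := Ths t.
  have [s' s'I es'] := circle_param_surj (UC s).
  exists s' => //; have /fib -> := es'.
  by rewrite /G es et' to_of// inE.
have OF0 : oval (F (G 0)) by have [] := HF _ _ Hflow 0.
have [tau' _ etau'] := sG _ OF0.
apply: (@conjugate_of_param R oval F G tau') => //.
- move=> s; have [_ d1 d2] := Hflow s.
  have c1 : {for s, continuous (fun t => (G t).1)}.
    by apply/differentiable_continuous/derivable1_diffP; exact: ex_derive.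
  have c2 : {for s, continuous (fun t => (G t).2)}.
    by apply/differentiable_continuous/derivable1_diffP; exact: ex_derive.
  exact: (cvg_pair c1 c2).
- apply: (oval_flow_unique (HF _ _ Hflow) (oval_flow_shift tau' Hflow)).
  by rewrite /= add0r; exact: esym etau'.
Qed.

End Flow.

(** * The minimum of the first integral *)

Section Minimum.
Context {R : realType} (al be ga de ep ze et : R).
Hypotheses (al0 : 0 < al) (be0 : 0 < be) (ga0 : 0 < ga) (de0 : 0 < de)
  (ep0 : 0 < ep) (ze0 : 0 < ze) (et0 : 0 < et) (dis0 : 4 * de * et <= ze ^+ 2).
Local Notation Q := (cubic al be ga de ep ze et).

(* Weighted AM-GM: in the coordinates (ln x, ln y) the function
   [cubic 0 x y / (x y)] is a sum of exponentials of linear forms, and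
   [1 + t <= expR t]. *)
Lemma cubic_min px py x y : 0 < px -> 0 < py -> 0 < x -> 0 < y ->
  al * px ^+ 2 * py + ga * px ^+ 2 - de * py ^+ 2 - ze * py - et = 0 ->
  be * px * py ^+ 2 - ga * px ^+ 2 + de * py ^+ 2 - ep * px - et = 0 ->
  (x, y) <> (px, py) ->
  Q 0 px py / (px * py) < Q 0 x y / (x * y).
Proof.
move=> px0 py0 xp yp c1 c2 ne.
have [s xE] : exists s, x = px * expR s.
  exists (ln (x / px)); rewrite lnK ?posrE ?divr_gt0//.
  by rewrite mulrC divfK// gt_eqF.
have [t yE] : exists t, y = py * expR t.
  exists (ln (y / py)); rewrite lnK ?posrE ?divr_gt0//.
  by rewrite mulrC divfK// gt_eqF.
have es0 := expR_gt0 s; have et'0 := expR_gt0 t.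
pose f (k : R) := expR k - (1 + k).
have f0 k : 0 <= f k by rewrite subr_ge0 expR_ge1Dx.
have fg k : k != 0 -> 0 < f k by move=> k0; rewrite subr_gt0 expR_gt1Dx.
(* Replacing each exponential by [f] removes linear terms whose total coefficients of [s] and [t]
   vanish by the two critical point equations. *)
have key : (Q 0 x y / (x * y) - Q 0 px py / (px * py)) * (px * py) =
    al * px ^+ 2 * py * f s + be * px * py ^+ 2 * f t + ga * px ^+ 2 * f (s - t)
    + de * py ^+ 2 * f (t - s) + ep * px * f (- t) + ze * py * f (- s)
    + et * f (- s - t).
  apply/eqP; rewrite -subr_eq0; apply/eqP.
  transitivity (s * (al * px ^+ 2 * py + ga * px ^+ 2 - de * py ^+ 2 - ze * py - et)
    + t * (be * px * py ^+ 2 - ga * px ^+ 2 + de * py ^+ 2 - ep * px - et)).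
    rewrite /f !expRD !expRN /cubic /cubA /cubB /cubC xE yE.
    move: (expR s) (expR t) es0 et'0 {f f0 fg xE yE} => S T S0 T0.
    by field; rewrite !gt_eqF.
  by rewrite c1 c2 !mulr0 addr0.
rewrite -subr_gt0 -(pmulr_lgt0 _ (mulr_gt0 px0 py0)) key.
have g1 : 0 <= al * px ^+ 2 * py * f s by rewrite !mulr_ge0 ?exprn_ge0// ltW.
have g2 : 0 <= be * px * py ^+ 2 * f t by rewrite !mulr_ge0 ?exprn_ge0// ltW.
have g3 : 0 <= ga * px ^+ 2 * f (s - t) by rewrite !mulr_ge0 ?exprn_ge0// ltW.
have g4 : 0 <= de * py ^+ 2 * f (t - s) by rewrite !mulr_ge0 ?exprn_ge0// ltW.
have g5 : 0 <= ep * px * f (- t) by rewrite !mulr_ge0// ltW.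
have g6 : 0 <= ze * py * f (- s) by rewrite !mulr_ge0// ltW.
have g7 : 0 <= et * f (- s - t) by rewrite !mulr_ge0// ltW.
have [s0|s0] := eqVneq s 0; last first.
  have : 0 < al * px ^+ 2 * py * f s by rewrite !mulr_gt0 ?exprn_gt0// fg.
  by lra.
have [t0|t0] := eqVneq t 0; last first.
  have : 0 < be * px * py ^+ 2 * f t by rewrite !mulr_gt0 ?exprn_gt0// fg.
  by lra.
by case: ne; rewrite xE yE s0 t0 expR0 !mulr1.
Qed.

(** Strict minimality gives [V p < h] for every nonempty level set off [p]. Hence the cubic is
    negative at [p], which starts [oval_rootsP], and [p] is not on the full level set. *)
Lemma cubic_level_sets (V : R * R -> R) (F : R * R -> R * R) (p : R * R) :
  (forall h x y, 0 < x -> 0 < y -> Q h x y = x * y * (V (x, y) - h)) ->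
  Qplus p -> (forall q, Qplus q -> q <> p -> V p < V q) ->
  (forall h w u, oval_flow al be ga de ep ze et h w u ->
     oval_flow al be ga de ep ze et h w (F \o u)) ->
  (forall h : R,
     let L := level_set (Qplus `\ p) V h in
     L !=set0 -> diffeomorphic L unit_circle /\ surrounds L p) /\
  (forall h : R,
     let L := level_set Qplus V h in
     L !=set0 -> L `<=` Qplus `\ p -> conjugate_to_rotation L F).
Proof.
move=> QV Qp min HF; have [p1 p2] := Qp.
have ovalE h : oval al be ga de ep ze et h = level_set Qplus V h.
  apply/seteqP; split=> [[x y] [/= xp yp]|[x y] [[/= xp yp] Vh]].
    rewrite QV// => /eqP; rewrite mulf_eq0 subr_eq0 => /orP[|/eqP Vh]; last by split.
    by rewrite mulf_eq0 !gt_eqF.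
  by split=> //=; rewrite QV// Vh subrr mulr0.
have levE h : V p < h -> level_set (Qplus `\ p) V h = level_set Qplus V h.
  move=> ph; apply/seteqP; split=> q [].
    by move=> [Qq _] Vq; split.
  move=> Qq Vq; split=> //; split=> //= qp.
  by move: ph; rewrite -Vq qp ltxx.
have roots h : V p < h -> Q h p.1 p.2 < 0.
  by move=> ph; rewrite QV// -surjective_pairing pmulr_rlt0 ?mulr_gt0// subr_lt0.
split=> h L [q [Qq Vq]].
  have ph : V p < h by rewrite -Vq; case: Qq => Qq /= qp; exact: min.
  have Qph := roots h ph.
  have [x0 [x1 [x2 [x3 Hr]]]] :=
    oval_rootsP al0 be0 ga0 de0 ep0 ze0 et0 dis0 p1 p2 Qph.
  rewrite /L levE// -ovalE; split; first exact: (oval_diffeomorphic _ _ _ _ _ _ Hr).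
  exact: (oval_surrounds _ _ _ _ _ _ _ Hr).
move=> LQ.
have ph : V p < h by rewrite -Vq; apply: min => //; have [] := LQ q (conj Qq Vq).
have Qph := roots h ph.
have [x0 [x1 [x2 [x3 Hr]]]] :=
  oval_rootsP al0 be0 ga0 de0 ep0 ze0 et0 dis0 p1 p2 Qph.
rewrite /L -ovalE; apply: (oval_conjugate_to_rotation _ _ _ _ _ _ _ Hr) => //.
exact: HF.
Qed.

End Minimum.

(** * Lyness maps *)

(** The arguments are the coefficients of the numerator of [V2 b a], in the order [x^2 y], [x y^2],
    [x^2], [y^2], [x], [y], [1]; likewise for [flow3] and [V3]. *)
Definition flow2 {R : realType} (b a : R) :=
  oval_flow a b b a (b ^+ 2 + a) (b + a ^+ 2) (a * b).

Definition flow3 {R : realType} (c b a : R) :=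
  oval_flow c a b b (a + b * c) (c + a * b) (a * c).

Lemma is_derive_lyness {R : realType} (u : R -> R * R) (a d1 d2 s : R) :
  (u s).1 != 0 ->
  is_derive s 1 (fun t => (u t).1) d1 -> is_derive s 1 (fun t => (u t).2) d2 ->
  is_derive s 1 (fun t => (lyness a (u t)).2)
    (d2 / (u s).1 - (a + (u s).2) * d1 / (u s).1 ^+ 2).
Proof.
move=> x0 h1 h2.
have hV : is_derive s 1 (fun t => ((u t).1)^-1) (- (u s).1 ^- 2 * d1).
  exact: is_deriveV.
rewrite /lyness/=; apply: is_derive_eq; rewrite /GRing.scale/=.
by field.
Qed.

(** The three identities say that the image lies on the target curve and that the differential of
    [lyness a] carries one field to the other. They are asked on the curve only, so that [h] can be
    eliminated. *)
Lemma lyness_oval_flow {R : realType} (al be ga de ep ze et : R)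
    (al' be' ga' de' ep' ze' et' a h w : R) (u : R -> R * R) :
  0 < a ->
  (forall x y, 0 < x -> 0 < y -> cubic al be ga de ep ze et h x y = 0 ->
    [/\ cubic al' be' ga' de' ep' ze' et' h y ((a + y) / x) = 0,
        - cubic_dy al' be' de' ze' h y ((a + y) / x) =
        cubic_dx al be ga ep h x y &
        cubic_dx al' be' ga' ep' h y ((a + y) / x) =
        cubic_dx al be ga ep h x y / x
        + (a + y) * cubic_dy al be de ze h x y / x ^+ 2]) ->
  oval_flow al be ga de ep ze et h w u ->
  oval_flow al' be' ga' de' ep' ze' et' h w (lyness a \o u).
Proof.
move=> a0 H Hu s; have [[x0 y0 QE] d1 d2] := Hu s.
have [Q' e1 e2] := H _ _ x0 y0 QE.
have xn : (u s).1 != 0 by rewrite gt_eqF.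
have d3 := is_derive_lyness a xn d1 d2.
split.
- by split=> //; rewrite /= divr_gt0// addr_gt0.
- by rewrite e1.
- by rewrite e2; apply: is_derive_eq d3 _; ring.
Qed.

Lemma cubic_level {R : realType} (al be ga de ep ze et h x y : R) :
  0 < x -> 0 < y -> cubic al be ga de ep ze et h x y = 0 ->
  h = cubic al be ga de ep ze et 0 x y / (x * y).
Proof.
move=> x0 y0 QE; apply: (canRL (mulfK _)); first by rewrite mulf_neq0// gt_eqF.
apply/esym/eqP; rewrite -subr_eq0; apply/eqP; rewrite -[RHS]QE.
by rewrite /cubic /cubA /cubB /cubC; ring.
Qed.

(** With [h] replaced by its value from [cubic_level], the conditions are rational identities. The
    parameters are swapped, so two steps return to the same curve. *)
Lemma lyness_flow2 {R : realType} (a b h w : R) (u : R -> R * R) :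
  0 < a -> flow2 b a h w u -> flow2 a b h w (lyness a \o u).
Proof.
move=> a0; apply: lyness_oval_flow => // x y x0 y0 /(cubic_level x0 y0) ->.
have ay : 0 < a + y by rewrite addr_gt0.
rewrite /cubic_dx /cubic_dy /cubic /cubA /cubB /cubC.
by split; field; rewrite !gt_eqF.
Qed.

(** Here the parameters are permuted cyclically, so three steps return to the same curve. *)
Lemma lyness_flow3 {R : realType} (a b c h w : R) (u : R -> R * R) :
  0 < a -> flow3 c b a h w u -> flow3 a c b h w (lyness a \o u).
Proof.
move=> a0; apply: lyness_oval_flow => // x y x0 y0 /(cubic_level x0 y0) ->.
have ay : 0 < a + y by rewrite addr_gt0.
rewrite /cubic_dx /cubic_dy /cubic /cubA /cubB /cubC.
by split; field; rewrite !gt_eqF.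
Qed.

(** Every fixed point is a critical point, hence a strict global minimum of [V], and two of them
    would contradict each other. Existence stays a hypothesis because the two maps lead to different
    polynomial equations. *)
Lemma cubic_first_integral {R : realType} (al be ga de ep ze et : R)
    (V : R * R -> R) (F : R * R -> R * R) :
  0 < al -> 0 < be -> 0 < ga -> 0 < de -> 0 < ep -> 0 < ze -> 0 < et ->
  4 * de * et <= ze ^+ 2 ->
  (forall h x y, 0 < x -> 0 < y ->
    cubic al be ga de ep ze et h x y = x * y * (V (x, y) - h)) ->
  (forall x y, 0 < x -> 0 < y -> F (x, y) = (x, y) ->
    al * x ^+ 2 * y + ga * x ^+ 2 - de * y ^+ 2 - ze * y - et = 0 /\
    be * x * y ^+ 2 - ga * x ^+ 2 + de * y ^+ 2 - ep * x - et = 0) ->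
  (forall h w u, oval_flow al be ga de ep ze et h w u ->
     oval_flow al be ga de ep ze et h w (F \o u)) ->
  (exists p, Qplus p /\ F p = p) ->
  (exists! p : R * R, Qplus p /\ F p = p) /\
  (forall p : R * R, Qplus p -> F p = p ->
    (forall h : R,
       let L := level_set (Qplus `\ p) V h in
       L !=set0 -> diffeomorphic L unit_circle /\ surrounds L p) /\
    (forall h : R,
       let L := level_set Qplus V h in
       L !=set0 -> L `<=` Qplus `\ p -> conjugate_to_rotation L F)).
Proof.
move=> al0 be0 ga0 de0 ep0 ze0 et0 dis0 QV crit HF [p0 [Qp0 Fp0]].
have min p q : Qplus p -> F p = p -> Qplus q -> q <> p -> V p < V q.
  case: p q => [px py] [x y] [/= px0 py0] Fp [/= xp yp] ne.
  have [c1 c2] := crit _ _ px0 py0 Fp.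
  have := cubic_min al0 be0 ga0 de0 ep0 ze0 et0 px0 py0 xp yp c1 c2 ne.
  have xy0 : 0 < x * y by rewrite mulr_gt0.
  have pp0 : 0 < px * py by rewrite mulr_gt0.
  by rewrite !QV// !subr0 ![_ * V _]mulrC !mulfK// gt_eqF.
split.
  exists p0; split=> // q [Qq Fq]; apply/eqP; apply: contraT => /eqP ne.
  have := min _ _ Qq Fq Qp0 ne.
  by rewrite ltNge ltW//; apply: min => // e; apply: ne.
move=> p Qp Fp; apply: (@cubic_level_sets R al be ga de ep ze et) => //.
by move=> q Qq ne; exact: min.
Qed.

(** * Fixed points: critical point equations and existence *)

Lemma lyness2_critical {R : realType} (a b x y : R) : 0 < x -> 0 < y ->
  lyness2 b a (x, y) = (x, y) ->
  a * x ^+ 2 * y + b * x ^+ 2 - a * y ^+ 2 - (b + a ^+ 2) * y - a * b = 0 /\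
  b * x * y ^+ 2 - b * x ^+ 2 + a * y ^+ 2 - (b ^+ 2 + a) * x - a * b = 0.
Proof.
move=> x0 y0; rewrite /lyness2 /lyness/= => -[e1]; rewrite e1 => e2.
(* The fixed point equations express [a] and [b] as polynomials in [x] and [y], which leaves
   polynomial identities. *)
have ya : a + y = x * x by rewrite -[X in _ = X * _]e1 divfK// gt_eqF.
have xb : b + x = y * y by rewrite -[X in _ = X * _]e2 divfK// gt_eqF.
have -> : a = x * x - y by rewrite -ya addrK.
have -> : b = y * y - x by rewrite -xb addrK.
by split; ring.
Qed.

(** The orbit has period three, [x], [y], [u]; its equations give [a], [b] and [c] as polynomials in
    these values. *)
Lemma lyness3_critical {R : realType} (a b c x y : R) : 0 < x -> 0 < y ->
  lyness3 c b a (x, y) = (x, y) ->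
  c * x ^+ 2 * y + b * x ^+ 2 - b * y ^+ 2 - (c + a * b) * y - a * c = 0 /\
  a * x * y ^+ 2 - b * x ^+ 2 + b * y ^+ 2 - (a + b * c) * x - a * c = 0.
Proof.
move=> x0 y0; rewrite /lyness3 /lyness/=; set u := (a + y) / x => -[e1].
rewrite e1 => e2.
have ux : a + y = u * x by rewrite /u divfK// gt_eqF.
have ub : b + u = x * y by rewrite -[X in _ = X * _]e1 divfK// gt_eqF.
(* A quotient by zero is zero, so [u = 0] would force [y = 0]. *)
have u0 : u != 0.
  apply: contra_eq_neq e2 => ->.
  by rewrite invr0 mulr0 eq_sym gt_eqF.
have uc : c + x = y * u by rewrite -[X in _ = X * _]e2 divfK.
have -> : a = u * x - y by rewrite -ux addrK.
have -> : b = x * y - u by rewrite -ub addrK.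
have -> : c = y * u - x by rewrite -uc addrK.
by split; ring.
Qed.

(** The equations are [y = x^2 - a] and [y^2 = b + x]; eliminating [y] gives [P]. A root beyond
    [sqrt a] makes [y] positive. *)
Lemma lyness2_fixed {R : realType} (a b : R) : 0 < a -> 0 < b ->
  exists p, Qplus p /\ lyness2 b a p = p.
Proof.
move=> a0 b0.
pose P : {poly R} := ('X ^+ 2 - a%:P) ^+ 2 - b%:P - 'X.
have PE x : P.[x] = (x ^+ 2 - a) ^+ 2 - b - x by rewrite /P !hornerE.
pose s := Num.sqrt a; have s0 : 0 < s by rewrite sqrtr_gt0.
have ss : s ^+ 2 = a by rewrite sqr_sqrtr// ltW.
(* Large enough for [M <= M^2 - a] and [b + M < M^2]. *)
pose M := 1 + a + b.
have sM : s <= M by rewrite /M; nra.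
have Ps : P.[s] < 0 by rewrite PE ss subrr expr0n/=; lra.
have PM : 0 < P.[M].
  have h1 : M <= M ^+ 2 - a by rewrite /M; nra.
  have h2 : M ^+ 2 <= (M ^+ 2 - a) ^+ 2 by rewrite ler_sqr// nnegrE /M; nra.
  rewrite PE; have : b + M < M ^+ 2 by rewrite /M; nra.
  by lra.
have [|x /andP[sx xM]] := @poly_ivt_oo R P s M sM.
  by rewrite pmulr_llt0.
rewrite PE => Px; have x0 : 0 < x by exact: lt_trans sx.
have y0 : 0 < x ^+ 2 - a.
  by rewrite subr_gt0 -ss ltr_sqr// nnegrE ltW.
exists (x, x ^+ 2 - a); split; first by split.
have e1 : (a + (x ^+ 2 - a)) / x = x by field; rewrite gt_eqF.
rewrite /lyness2 /lyness/= e1; congr (_, _).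
apply: (canLR (mulfK _)); first by rewrite gt_eqF.
by rewrite -expr2; lra.
Qed.

(** With [u = x y - b], the equation [a + y = x u] gives [y (x^2 - 1) = a + b x], so a root [x > 1]
    is sought. [P] is [c + x = y u] multiplied by [x (x^2 - 1)^2]. *)
Lemma lyness3_fixed {R : realType} (a b c : R) : 0 < a -> 0 < b -> 0 < c ->
  exists p, Qplus p /\ lyness3 c b a p = p.
Proof.
move=> a0 b0 c0.
pose P : {poly R} := ('X ^+ 2 + c%:P * 'X) * ('X ^+ 2 - 1) ^+ 2
  - (a%:P + b%:P * 'X) * (a%:P * ('X ^+ 2 - 1) + (a%:P + b%:P * 'X)).
have PE x : P.[x] = (x ^+ 2 + c * x) * (x ^+ 2 - 1) ^+ 2
  - (a + b * x) * (a * (x ^+ 2 - 1) + (a + b * x)).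
  by rewrite /P !hornerE.
pose k := a + b; have k0 : 0 < k by rewrite addr_gt0.
pose M := 1 + k.
have M1 : 1 <= M by rewrite lerDl ltW.
have P1 : P.[1] < 0.
  rewrite PE (_ : _ - _ = - (k ^+ 2)); last by rewrite /k; ring.
  by rewrite oppr_lt0 exprn_gt0.
(* As [M - 1 = k], the first term of [P] exceeds [M^4 k^2], while the subtracted product is at most
   [k^2 M^3]. *)
have PM : 0 < P.[M].
  have M0 : 0 < M by lra.
  have h1 : M * k <= M ^+ 2 - 1 by rewrite /M; nra.
  have h2 : (M * k) ^+ 2 <= (M ^+ 2 - 1) ^+ 2.
    have Mk : 0 <= M * k by rewrite mulr_ge0// ltW.
    by rewrite ler_sqr ?nnegrE// (le_trans _ h1).
  have h3 : M ^+ 2 * (M * k) ^+ 2 < (M ^+ 2 + c * M) * (M ^+ 2 - 1) ^+ 2.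
    apply: (@lt_le_trans _ _ ((M ^+ 2 + c * M) * (M * k) ^+ 2)).
      by rewrite ltr_pM2r ?exprn_gt0 ?mulr_gt0// ltrDl mulr_gt0.
    by rewrite ler_wpM2l// addr_ge0 ?mulr_ge0 ?exprn_ge0// ltW.
  have h4 : a + b * M <= k * M by rewrite /k; nra.
  have h5 : a * (M ^+ 2 - 1) + (a + b * M) <= k * M ^+ 2 by rewrite /k; nra.
  have h6 : (a + b * M) * (a * (M ^+ 2 - 1) + (a + b * M)) <= (k * M) * (k * M ^+ 2).
    have g1 : 0 <= a + b * M by rewrite addr_ge0 ?mulr_ge0// ltW.
    apply: ler_pM => //; rewrite addr_ge0// mulr_ge0 ?(ltW a0)// subr_ge0.
    by rewrite exprn_ege1.
  have h7 : (k * M) * (k * M ^+ 2) <= M ^+ 2 * (M * k) ^+ 2.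
    have -> : M ^+ 2 * (M * k) ^+ 2 = M * ((k * M) * (k * M ^+ 2)) by ring.
    by rewrite ler_peMl// !mulr_ge0 ?exprn_ge0// ltW.
  by rewrite PE; lra.
have [|x /andP[x1 xM]] := @poly_ivt_oo R P 1 M M1.
  by rewrite pmulr_llt0.
rewrite PE => Px; have x0 : 0 < x by lra.
have d0 : 0 < x ^+ 2 - 1 by nra.
pose y := (a + b * x) / (x ^+ 2 - 1).
have y0 : 0 < y by rewrite divr_gt0// addr_gt0// mulr_gt0.
have yE : y * (x ^+ 2 - 1) = a + b * x by rewrite divfK// gt_eqF.
pose u := x * y - b.
have uE : (a + y) / x = u.
  apply: (canLR (mulfK _)); first by rewrite gt_eqF.
  by rewrite /u -[a](addrK (b * x)) -yE; ring.
have u0 : 0 < u by rewrite -uE divr_gt0// addr_gt0.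
have uc : c + x = y * u.
  apply: (@mulfI _ (x * (x ^+ 2 - 1) ^+ 2)).
    by rewrite mulf_neq0// gt_eqF// exprn_gt0.
  have ux : x * u = a + y by rewrite -uE mulrC divfK// gt_eqF.
  have -> : x * (x ^+ 2 - 1) ^+ 2 * (y * u) =
     (y * (x ^+ 2 - 1)) * ((x ^+ 2 - 1) * (x * u)) by ring.
  have e : (x ^+ 2 - 1) * (a + y) = a * (x ^+ 2 - 1) + (a + b * x).
    by rewrite -yE; ring.
  rewrite ux yE e.
  by apply/eqP; rewrite -subr_eq0; apply/eqP; rewrite -[RHS]Px; ring.
exists (x, y); split; first by split.
have e1 : (b + u) / y = x by rewrite /u; field; rewrite gt_eqF.
rewrite /lyness3 /lyness/= uE e1; congr (_, _).
by rewrite uc mulfK// gt_eqF.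
Qed.

Theorem theorem2 (R : realType) (a b c : R) (ha : 0 < a) (hb : 0 < b) (hc : 0 < c) :
  ((exists! p : R * R, Qplus p /\ lyness2 b a p = p) /\
   (forall p : R * R, Qplus p -> lyness2 b a p = p ->
      (forall h : R,
         let L := level_set (Qplus `\ p) (V2 b a) h in
         L !=set0 -> diffeomorphic L unit_circle /\ surrounds L p) /\
      (forall h : R,
         let L := level_set Qplus (V2 b a) h in
         L !=set0 -> L `<=` Qplus `\ p ->
         conjugate_to_rotation L (lyness2 b a))))
  /\
  ((exists! p : R * R, Qplus p /\ lyness3 c b a p = p) /\
   (forall p : R * R, Qplus p -> lyness3 c b a p = p ->
      (forall h : R,
         let L := level_set (Qplus `\ p) (V3 c b a) h in
         L !=set0 -> diffeomorphic L unit_circle /\ surrounds L p) /\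
      (forall h : R,
         let L := level_set Qplus (V3 c b a) h in
         L !=set0 -> L `<=` Qplus `\ p ->
         conjugate_to_rotation L (lyness3 c b a)))).
Proof.
split.
  apply: (@cubic_first_integral R a b b a (b ^+ 2 + a) (b + a ^+ 2) (a * b)) => //.
  - by rewrite addr_gt0// exprn_gt0.
  - by rewrite addr_gt0// exprn_gt0.
  - by rewrite mulr_gt0.
  (* This square is the value of the discriminant at 0. It may vanish, which is why [oval_roots]
     admits [x0 = 0]. *)
  - have := sqr_ge0 (b - a ^+ 2); have -> : (b - a ^+ 2) ^+ 2 =
      (b + a ^+ 2) ^+ 2 - 4 * a * (a * b) by ring.
    by rewrite subr_ge0.
  - move=> h x y x0 y0; rewrite /V2 /cubic /cubA /cubB /cubC.
    by field; rewrite !gt_eqF.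
  - exact: lyness2_critical.
  - by move=> h w u /(lyness_flow2 ha) /(lyness_flow2 hb).
  - exact: lyness2_fixed.
apply: (@cubic_first_integral R c a b b (a + b * c) (c + a * b) (a * c)) => //.
- by rewrite addr_gt0// mulr_gt0.
- by rewrite addr_gt0// mulr_gt0.
- by rewrite mulr_gt0.
- have := sqr_ge0 (c - a * b); have -> : (c - a * b) ^+ 2 =
    (c + a * b) ^+ 2 - 4 * b * (a * c) by ring.
  by rewrite subr_ge0.
- move=> h x y x0 y0; rewrite /V3 /cubic /cubA /cubB /cubC.
  by field; rewrite !gt_eqF.
- exact: lyness3_critical.
- by move=> h w u /(lyness_flow3 ha) /(lyness_flow3 hb) /(lyness_flow3 hc).
- exact: lyness3_fixed.
Qed.
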